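(* Let $n,d$ be positive integers and let $X = H Z$, where $H\in\mathbb{R}^{d\times n}$ is an unknown matrix of full column rank and $Z=(Z_1,\dots,Z_n)^\top$ is an unobserved random vector generated by the structural equations $Z_i = f_i(Z_{pa(i)}) + \mathcal{E}_i$, $i\in[n]$, with respect to an unknown directed acyclic graph $\mathcal{G}$ on $[n]$, where each $f_i$ is twice continuously differentiable and directionally non-linear, and $\mathcal{E}_1,\dots,\mathcal{E}_n$ are mutually independent with $\mathcal{E}_i\sim\mathcal{N}(0,\sigma_i^2)$. Then the latent variables $Z$ are identifiable up to upstream layers from the distribution $p_X$ of $X$ alone: it is possible to learn from $p_X$ a map $\hat Z:\mathbb{R}^d\to\mathbb{R}^n$ such that $\hat Z(X) = P_\pi\, C\, Z$ for all $Z\in\mathbb{R}^n$, where $P_\pi\in\mathbb{R}^{n\times n}$ is a permutation matrix and $C\in\mathbb{R}^{n\times n}$ is a constant matrix with non-zero diagonal entries and $C_{ij}=0$ whenever $i\in layer(k)$ and $j\in\bigcup_{l<k} layer(l)$.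
   Context: $pa(i)$ denotes the set of parents of node $i$ in $\mathcal{G}$ and $Z_{pa(i)}$ the corresponding subvector. A function $f_i:\mathbb{R}^{|pa(i)|}\to\mathbb{R}$ is directionally non-linear if there is no $\beta\in\mathbb{R}^{|pa(i)|}$ with $\|\beta\|_2=1$ such that the second directional derivative $\partial^2_{\beta,\beta} f_i(z)=0$ for all $z$. A leaf node is a node with no descendants in $\mathcal{G}$. For $k\ge 0$, $layer(k)$ is the set of nodes of $\mathcal{G}$ whose longest directed path to a leaf node has length $k$ (so $layer(0)$ is the set of leaves). Only samples of $X$ (equivalently, the distribution $p_X$) are available; no interventions. *)

(* Defs.v *)
From HB Require Import structures.
From mathcomp Require Import all_boot all_order all_algebra all_fingroup.
From mathcomp Require Import all_classical all_reals all_analysis.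
Set Implicit Arguments. Unset Strict Implicit. Unset Printing Implicit Defensive.
Import Order.TTheory GRing.Theory Num.Theory.
Import numFieldNormedType.Exports.
Local Open Scope classical_set_scope.
Local Open Scope ring_scope.

Section Defs.
Variable R : realType.

(* A directed graph is an edge relation G : rel 'I_n, with  G j i  meaning
   that there is an edge j -> i, i.e. j is a parent of i:  pa(i) = [pred j | G j i]. *)

Definition acyclic (n : nat) (G : rel 'I_n) : Prop :=
  forall i j, G i j -> ~~ connect G j i.

Definition leaf (n : nat) (G : rel 'I_n) (i : 'I_n) : Prop :=
  forall j, ~~ G i j.

Definition in_layer (n : nat) (G : rel 'I_n) (k : nat) (i : 'I_n) : Prop :=
  (exists s : seq 'I_n, [/\ path G i s, size s = k & leaf G (last i s)]) /\
  (forall s : seq 'I_n, path G i s -> leaf G (last i s) -> (size s <= k)%N).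

Definition depends_only_on (n : nat) (P : pred 'I_n) (f : 'cV[R]_n -> R) : Prop :=
  forall x y : 'cV[R]_n, (forall j, P j -> x j 0 = y j 0) -> f x = f y.

Definition ecv (n : nat) (j : 'I_n) : 'cV[R]_n := \col_k (k == j)%:R.

Definition C2 (n : nat) (f : 'cV[R]_n -> R) : Prop :=
  [/\ forall x, differentiable f x,
      forall (j : 'I_n) x, differentiable ('D_(ecv j) f) x
    & forall j k : 'I_n, continuous ('D_(ecv k) ('D_(ecv j) f))].

Definition dir_nonlinear (n : nat) (P : pred 'I_n) (f : 'cV[R]_n -> R) : Prop :=
  ~ exists beta : 'cV[R]_n,
      [/\ forall j, ~~ P j -> beta j 0 = 0,
          \sum_j (beta j 0) ^+ 2 = 1
        & forall z, 'D_beta ('D_beta f) z = 0].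

(* solution of Z_i = f_i(Z) + e_i on a DAG with n nodes: n iterations of the
   structural map starting from 0 (after n steps this is the unique solution) *)
Definition sem_step (n : nat) (f : 'I_n -> 'cV[R]_n -> R) (e z : 'cV[R]_n)
  : 'cV[R]_n := \col_i (f i z + e i 0).
Definition sem (n : nat) (f : 'I_n -> 'cV[R]_n -> R) (e : 'cV[R]_n) : 'cV[R]_n :=
  iter n (sem_step f e) 0.

Fixpoint iint (m : nat) (F : (nat -> R) -> R) : R :=
  match m with
  | 0 => F (fun _ => 0)
  | m'.+1 => iint m' (fun v =>
       \int[@lebesgue_measure R]_(x in setT)
          F (fun k => if k == m' then x else v k))
  end.

Definition gauss_expect (n : nat) (sigma : 'I_n -> R) (g : 'cV[R]_n -> R) : R :=
  iint n (fun v => g (\col_i v i) * \prod_i normal_pdf 0 (sigma i) (v i)).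

(* The distribution p_X of X = H Z, represented by its characteristic function
   t |-> E[exp(i t.X)] = (E[cos(t.X)], E[sin(t.X)]). *)
Definition law_X (n d : nat) (H : 'M[R]_(d, n)) (f : 'I_n -> 'cV[R]_n -> R)
  (sigma : 'I_n -> R) (t : 'cV[R]_d) : R * R :=
  (gauss_expect sigma (fun e => cos ((t^T *m (H *m sem f e)) 0 0)),
   gauss_expect sigma (fun e => sin ((t^T *m (H *m sem f e)) 0 0))).

End Defs.

(* Main.v *)
Require Import Defs.
From HB Require Import structures.
From mathcomp Require Import all_boot all_order all_algebra all_fingroup.
From mathcomp Require Import all_classical all_reals all_analysis.
From mathcomp Require Import measurable_realfun ring lra zify.
Set Implicit Arguments. Unset Strict Implicit. Unset Printing Implicit Defensive.
Import Order.TTheory GRing.Theory Num.Theory.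
Import numFieldNormedType.Exports.
Local Open Scope classical_set_scope.
Local Open Scope ring_scope.

(** Two models with the same law have H = H0 A with A invertible, and it
    suffices to show that A respects the layers of the two graphs.

    Products of cosines of affine forms are combinations of such cosines, so
    equal characteristic functions give equal expectations of those products,
    and of their limits exp (- |X - x|^2 / 2 s^2), because
    cos (a / sqrt N) ^ N tends to exp (- a^2 / 2).  The substitution
    e_i = z_i - f_i z, one node at a time in a topological order, shows that Z
    has the density prod_i N(0, sigma_i)(z_i - f_i z); letting s tend to 0 in
    the coordinates w = (z - z0) / s, this density at z0 agrees, up to a
    constant factor, with that of the other model at A z0.  Hence the quadratic
    energies q z = sum_i (z_i - f_i z)^2 / sigma_i^2 satisfy q = q0 o A, the
    additive constant being 0 as both minima are 0.

    Write q_k for the part of q carried by the nodes of layer at least k.  The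
    second differences of q_k along b do not depend on the base point iff b is
    supported on layers at most k: if not, take a node i of minimal layer among
    those with a parent in the support of b; the second difference has in z_i
    the coefficient - 2 (f_i (z + t b) + f_i (z - t b) - 2 f_i z) / sigma_i^2,
    whose vanishing contradicts directional nonlinearity.  As q_(k+1) is the
    minimum of q_k over translations by that subspace, induction on k shows that
    A maps the span of the layers at most k of one model into that of the other.
    A nonzero term of the Leibniz formula for det A yields the permutation. *)

(** * Integration on the line *)

Section OneDim.
Variable R : realType.
Local Notation mu := (@lebesgue_measure R).
Implicit Types f g w : R -> R.

Lemma continuous_measurableT f : continuous f -> measurable_fun setT f.
Proof.
by move=> cf; apply: continuous_measurable_fun.
Qed.

Lemma dominated_integrable1 f g : measurable_fun setT f ->
  mu.-integrable setT (EFin \o g) -> (forall x, `|f x| <= g x) ->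
  mu.-integrable setT (EFin \o f).
Proof.
move=> mf ig fg; apply: le_integrable ig => //.
  exact/measurable_EFinP.
by move=> x _ /=; rewrite lee_fin (le_trans (fg x)) // ler_norm.
Qed.

Lemma Rintegral_dominated_cvg (f_ : nat -> R -> R) f g :
  (forall n, measurable_fun setT (f_ n)) -> measurable_fun setT f ->
  (forall x, f_ n x @[n --> \oo] --> f x) ->
  mu.-integrable setT (EFin \o g) -> (forall n x, `|f_ n x| <= g x) ->
  (\int[mu]_x f_ n x) @[n --> \oo] --> \int[mu]_x f x.
Proof.
move=> mf_ mf ff ig fg.
have [|||||] := @dominated_convergence _ _ _ mu setT measurableT
  (fun n => EFin \o f_ n) (EFin \o f) (EFin \o g).
- by move=> n; apply/measurable_EFinP; exact: mf_.
- exact/measurable_EFinP.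
- by apply: aeW => x _; apply: cvg_EFin; [apply: nearW|exact: ff].
- exact: ig.
- by apply: aeW => x n _ /=; rewrite lee_fin.
move=> intf _ cv; rewrite /Rintegral.
have fint := integrable_fin_num measurableT intf.
by apply: fine_cvg; rewrite fineK.
Qed.

(** The substitution formula for non-negative integrands yields the equality of the integrals first;
    integrability of the rescaled function is then read off from finiteness of its integral. *)
Lemma Rintegral_affine f (a e : R) : 0 < e -> continuous f -> (forall x, 0 <= f x) ->
  mu.-integrable setT (EFin \o f) ->
  mu.-integrable setT (EFin \o (fun x => f (a + e * x))) /\
  \int[mu]_x f x = e * \int[mu]_x f (a + e * x).
Proof.
move=> e0 cf f0 intf.
have dF (x : R) : is_derive x (1:R) (fun x => a + e * x) e.
  by apply: is_derive_eq; rewrite add0r mul1r /GRing.scale /= mulr1.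
have F1E : derive1 (fun x : R => a + e * x) = cst e.
  by apply/funext => x; rewrite derive1E; exact: derive_val.
have cF : continuous (fun x => f (a + e * x)).
  move=> x; apply: (@continuous_comp _ _ _ (fun x => a + e * x) f); last exact: cf.
  apply: (@cvgD _ R^o); first exact: cvg_cst.
  by apply: cvgM; [exact: cvg_cst|exact: cvg_id].
have E : (\int[mu]_x (f x)%:E = \int[mu]_x ((e * f (a + e * x))%:E))%E.
  rewrite (@increasing_ge0_integration_by_substitutionT _ (fun x => a + e * x)) //.
  - by apply: eq_integral => x _ /=; rewrite F1E /= /GRing.mul /= mulrC.
  - by move=> x y xy; rewrite ltrD2l ltr_pM2l.
  - by rewrite F1E => x; exact: cvg_cst.
  - by rewrite F1E; exact: is_cvg_cst.
  - by rewrite F1E; exact: is_cvg_cst.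
  - apply/cvgrNyPle => A; near=> x.
    rewrite -lerBrDl mulrC -ler_pdivlMr //; near: x.
  - apply/cvgryPge => A; near=> x.
    rewrite -lerBlDl mulrC -ler_pdivrMr //; near: x.
have i2 : mu.-integrable setT (EFin \o (fun x => e * f (a + e * x))).
  apply/integrableP; split.
    apply/measurable_EFinP/measurable_funM => //.
    exact: continuous_measurableT.
  have /integrableP[_] := intf.
  under eq_integral do rewrite /= ger0_norm //.
  rewrite E; congr (_ < _)%E; apply: eq_integral => x _ /=.
  by rewrite ger0_norm // mulr_ge0 // ltW.
have i3 : mu.-integrable setT (EFin \o (fun x => f (a + e * x))).
  have := integrableZl measurableT e^-1 i2.
  congr (mu.-integrable setT _); apply/funext => x /=.
  by rewrite -EFinM mulKf // gt_eqF.
split => //; rewrite -RintegralZl // /Rintegral E //.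
Unshelve. all: end_near. Qed.

(** A positive value at [x0] would keep f above half of it on a ball, and a ball has positive
    measure. *)
Lemma Rintegral_eq0_continuous f : continuous f -> (forall x, 0 <= f x) ->
  mu.-integrable setT (EFin \o f) -> \int[mu]_x f x = 0 -> forall x, f x = 0.
Proof.
move=> cf f0 intf I0 x0; apply/eqP; rewrite eq_le f0 andbT leNgt; apply/negP => fx0.
have mf := continuous_measurableT cf.
have I0' : (\int[mu]_x (f x)%:E = 0)%E.
  by rewrite -[LHS]fineK ?(integrable_fin_num measurableT intf) // -[X in X%:E]/(Rintegral mu setT f) I0.
have : \forall x \near x0, f x0 / 2 < f x.
  by apply: (cvgr_gt _ (cf x0)); rewrite ltr_pdivrMr // ltr_pMr // ltr1n.
move=> /nbhs_ballP[r /= r0 br].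
have : ((f x0 / 2)%:E * mu (ball x0 r) <= 0)%E.
  rewrite -I0' -integral_cst ?(measurable_ball x0 r) //.
  apply: (@le_trans _ _ (\int[mu]_(x in ball x0 r) (f x)%:E)%E); last first.
    apply: ge0_subset_integral => //; last by move=> x _; rewrite lee_fin.
    exact: measurable_ball. exact/measurable_EFinP.
  apply: ge0_le_integral => //.
  - exact: measurable_ball.
  - by move=> x _; rewrite lee_fin divr_ge0 // ltW.
  - by apply/measurable_EFinP; exact: measurable_funTS.
  - by move=> x xb; rewrite lee_fin ltW // br.
  exact: measurable_ball.
rewrite lebesgue_measure_ball; last exact: ltW.
by rewrite -EFinM lee_fin leNgt mulr_gt0 // ?divr_gt0 // ?mulrn_wgt0.
Qed.

(* h is the limit of (x, y) |-> h (floor (N x) / N) y, measurable on each strip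
   where floor (N x) is constant. *)
Lemma measurable_fun_caratheodory (h : R -> R -> R) :
  (forall x, measurable_fun setT (h x)) ->
  (forall y (u : nat -> R) x, u n @[n --> \oo] --> x -> h (u n) y @[n --> \oo] --> h x y) ->
  measurable_fun setT (fun xy : R * R => h xy.1 xy.2).
Proof.
move=> mh ch.
pose N n : R := n.+1%:R.
have N0 n : 0 < N n by rewrite ltr0n.
pose r n x : R := (Num.floor (N n * x))%:~R / N n.
have rcvg x : r n x @[n --> \oo] --> x.
  have xl n : x - (N n)^-1 <= r n x.
    rewrite -(ler_pM2l (N0 n)) mulrBr divff ?gt_eqF // mulrCA divff ?gt_eqF // mulr1.
    by rewrite lerBlDr ltW // -[1]/(1%:~R) -intrD floorD1_gt.
  have xr n : r n x <= x.
    by rewrite ler_pdivrMr // [leRHS]mulrC floor_le.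
  apply: (@squeeze_cvgr _ _ _ _ (fun n => x - (N n)^-1) (cst x)).
  - by apply: nearW => n; rewrite xl xr.
  - rewrite -[X in _ --> X]subr0; apply: (@cvgB _ R^o); first exact: cvg_cst.
    exact: cvg_harmonic.
  - exact: cvg_cst.
apply: (measurable_fun_cvg (h := fun n xy => h (r n xy.1) xy.2)).
  move=> n.
  (* The strips are indexed by integers; [unpickle] arranges them in a sequence, which makes the
     union countable. *)
  pose E k : set (R * R) := if unpickle k is Some m then
    [set x | (m%:~R <= N n * x) && (N n * x < (m + 1)%:~R)] `*` setT else set0.
  have -> : [set: R * R] = \bigcup_k E k.
    apply/esym; rewrite -subTset => -[x y] _.
    exists (pickle (Num.floor (N n * x))) => //; rewrite /E pickleK /=; split => //=.
    by rewrite floor_le // floorD1_gt .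
  apply/measurable_fun_bigcup => k; rewrite /E.
    case: (unpickle k) => [m|//].
    apply: measurableX => //.
    rewrite (_ : [set x | _] = `[m%:~R / N n, (m + 1)%:~R / N n[%classic).
      exact: measurable_itv.
    apply/seteqP; split => x /=; rewrite in_itv /=.
      by rewrite ler_pdivrMr // ltr_pdivlMr // ![_ * N n]mulrC.
    by rewrite ler_pdivrMr // ltr_pdivlMr // ![_ * N n]mulrC.
  case: (unpickle k) => [m|]; last exact: measurable_fun_set0.
  apply: (eq_measurable_fun (fun xy : R * R => h (m%:~R / N n) xy.2)).
    move=> -[x y]; rewrite inE => -[/= xm _].
    by rewrite /r (@floor_def _ _ m).
  apply: measurable_funTS; exact: (measurableT_comp (mh (m%:~R / N n)) measurable_snd).
by move=> -[x y] _ /=; apply: ch.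
Qed.
End OneDim.

(** * Iterated integrals *)

Section Iterated.
Variable R : realType.
Local Notation mu := (@lebesgue_measure R).
Implicit Types (F G : (nat -> R) -> R) (v : nat -> R) (w : nat -> R -> R).

Definition upd v k x : nat -> R := fun j => if j == k then x else v j.

Lemma upd_same v k x : upd v k x k = x.
Proof. by rewrite /upd eqxx. Qed.

Lemma upd_neq v k x j : j != k -> upd v k x j = v j.
Proof. by rewrite /upd => /negbTE ->. Qed.

Lemma updC v j k x y : j != k -> upd (upd v j x) k y = upd (upd v k y) j x.
Proof.
move=> jk; apply/funext => i; rewrite /upd; have [->|//] := eqVneq i k.
by rewrite eq_sym (negbTE jk).
Qed.

(** Continuity for pointwise convergence, in the sequential form that dominated convergence passes
    on to [Iop]. *)
Definition seqcont F := forall (u : nat -> nat -> R) v,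
  (forall k, u N k @[N --> \oo] --> v k) -> F (u N) @[N --> \oo] --> F v.

Lemma seqcont_upd F v k : seqcont F -> continuous (fun x => F (upd v k x)).
Proof.
move=> cF x; apply/(@cvg_nbhsP _ R^o) => u ux.
apply: cF => j; rewrite /upd; case: eqP => // _; exact: cvg_cst.
Qed.

Definition weight (f : R -> R) :=
  [/\ continuous f, forall x, 0 <= f x & mu.-integrable setT (EFin \o f)].

Definition Iop k F v := \int[mu]_x F (upd v k x).
Definition iints s F := foldr Iop F s.

Lemma iintE m F : iint m F = iints (iota 0 m) F (fun=> 0).
Proof.
elim: m F => [//|m IH] F; rewrite [LHS]IH -addn1 iotaD /iints foldr_cat //.
Qed.

(* The bound is required on all of nat -> R: the coordinates outside s act as
   parameters, which makes the class stable under Iop. *)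
Definition good w C (s : seq nat) F :=
  seqcont F /\ forall v, `|F v| <= C * \prod_(k <- s) w k (v k).

Lemma iints_ge0 s F v : (forall v, 0 <= F v) -> 0 <= iints s F v.
Proof.
by move=> F0; elim: s v => [|k s IH] v //=; apply: Rintegral_ge0 => x _; exact: IH.
Qed.

Section Weights.
Variable w : nat -> R -> R.
Hypothesis hw : forall k, weight (w k).

Let w_ge0 k x : 0 <= w k x. Proof. by case: (hw k). Qed.

Lemma prod_weight_ge0 s v : 0 <= \prod_(k <- s) w k (v k).
Proof. exact: prodr_ge0. Qed.

Lemma prod_weight_upd s k v x : k \notin s ->
  \prod_(j <- s) w j (upd v k x j) = \prod_(j <- s) w j (v j).
Proof.
move=> ks; apply: eq_big_seq => j js; rewrite upd_neq //.
by apply: contraNneq ks => <-.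
Qed.

Lemma prod_weight_seqcont s : seqcont (fun v => \prod_(k <- s) w k (v k)).
Proof.
elim: s => [|k s IH] u v uv.
  rewrite big_nil (_ : (fun _ => _) = cst 1); first exact: cvg_cst.
  by apply/funext => N; rewrite big_nil.
rewrite big_cons (_ : (fun _ => _) =
  (fun N => w k (u N k) * \prod_(j <- s) w j (u N j))); last first.
  by apply/funext => N; rewrite big_cons.
apply: cvgM; last exact: IH.
by apply: cvg_comp (uv k) _; case: (hw k) => cw _ _; exact: cw.
Qed.

Lemma good_perm C s s' F : perm_eq s s' -> good w C s F -> good w C s' F.
Proof. by move=> ss' [cF bF]; split=> // v; rewrite -(perm_big _ ss'). Qed.

Lemma good_integrable C k s F v : k \notin s -> good w C (k :: s) F ->
  mu.-integrable setT (EFin \o (fun x => F (upd v k x))).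
Proof.
move=> ks [cF bF]; have [_ _ iw] := hw k.
apply: (@dominated_integrable1 _ _
  (fun x => (C * \prod_(j <- s) w j (v j)) * w k x)).
- apply: continuous_measurableT; exact: seqcont_upd.
- have := integrableZl measurableT (C * \prod_(j <- s) w j (v j)) iw.
  by congr (mu.-integrable setT _); apply/funext => x /=; rewrite EFinM.
- move=> x; rewrite (le_trans (bF _)) // big_cons upd_same prod_weight_upd //.
  by rewrite mulrAC mulrA.
Qed.

(** Along a convergent sequence of parameters the product of the remaining weights is bounded, so a
    constant multiple of [w k] dominates and the integral is continuous in the parameters. *)
Lemma good_Iop C k s F : k \notin s -> good w C (k :: s) F ->
  good w (C * \int[mu]_x w k x) s (Iop k F).
Proof.
move=> ks gF; have [cF bF] := gF; have [cw w0 iw] := hw k; split.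
  move=> u v uv.
  have /cvgP /cvg_seq_bounded [M [_ /(_ (M + 1))]] := @prod_weight_seqcont s u v uv.
  rewrite ltrDl ltr01 => /(_ isT) bM.
  apply: (@Rintegral_dominated_cvg _ _ _ (fun x => (`|C| * (M + 1)) * w k x)).
  - by move=> n; apply: continuous_measurableT; exact: seqcont_upd.
  - apply: continuous_measurableT; exact: seqcont_upd.
  - move=> x; apply: cF => j; rewrite /upd; case: eqP => // _; exact: cvg_cst.
  - have := integrableZl measurableT (`|C| * (M + 1)) iw.
    by congr (mu.-integrable setT _); apply/funext => x /=; rewrite EFinM.
  - move=> n x; rewrite (le_trans (bF _)) // big_cons upd_same prod_weight_upd //.
    rewrite mulrCA mulrC ler_wpM2r //.
    apply: (@le_trans _ _ (`|C| * \prod_(j <- s) w j (u n j))).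
      by rewrite ler_wpM2r ?prod_weight_ge0 // ler_norm.
    rewrite ler_wpM2l //; apply: le_trans (bM n I).
    exact: ler_norm.
move=> v; rewrite /Iop.
have iF := good_integrable v ks gF.
apply: (le_trans (le_normr_Rintegral measurableT iF)).
rewrite mulrAC -RintegralZl //; apply: le_Rintegral => //.
- by have := integrable_norm iF.
- have := integrableZl measurableT (C * \prod_(j <- s) w j (v j)) iw.
  by congr (mu.-integrable setT _); apply/funext => x /=; rewrite EFinM.
- move=> x _; rewrite (le_trans (bF _)) // big_cons upd_same prod_weight_upd //.
  by rewrite mulrAC mulrA.
Qed.

Lemma good_iints C s r F : uniq (s ++ r) -> good w C (s ++ r) F ->
  good w (C * \prod_(k <- s) \int[mu]_x w k x) r (iints s F).
Proof.
elim: s r => [|k s IH] r; first by rewrite big_nil mulr1.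
move=> u gF; rewrite big_cons mulrCA mulrC /=.
have p : perm_eq (k :: s ++ r) (s ++ k :: r) by rewrite -cat1s perm_catCA.
move: u; rewrite (perm_uniq p) => u.
have kr : k \notin r by move: u; rewrite cat_uniq => /and3P[_ _ /= /andP[]].
have := IH (k :: r) u (good_perm p gF).
by move=> /(good_Iop kr); rewrite -mulrA [X in _ * X]mulrC mulrA.
Qed.

(** Fubini's theorem: separate continuity gives joint measurability, and the bound
    [K * w a x * w b y] gives integrability on the plane. *)
Lemma Iop_swap C a b s F : uniq [:: a, b & s] -> good w C [:: a, b & s] F ->
  Iop a (Iop b F) = Iop b (Iop a F).
Proof.
move=> /= /and3P[]; rewrite inE negb_or => /andP[ab as_ bs _] gF.
have [cF bF] := gF; apply/funext => v; rewrite /Iop.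
have gF' : good w C [:: b, a & s] F.
  by apply: good_perm gF; apply/seq.permP => P /=; rewrite addnCA.
have ib x : mu.-integrable setT (EFin \o (fun y => F (upd (upd v a x) b y))).
  apply: (@good_integrable C b (a :: s)) => //.
  by rewrite inE negb_or eq_sym ab.
have ia y : mu.-integrable setT (EFin \o (fun x => F (upd (upd v b y) a x))).
  apply: (@good_integrable C a (b :: s)) => //.
  by rewrite inE negb_or ab.
pose h xy := F (upd (upd v a xy.1) b xy.2).
have mh : measurable_fun setT h.
  apply: (@measurable_fun_caratheodory _ (fun x y => F (upd (upd v a x) b y))).
    by move=> x; apply: continuous_measurableT; exact: seqcont_upd.
  move=> y u x ux; apply: cF => j; rewrite /upd; case: eqP => // _; first exact: cvg_cst.
  by case: eqP => // _; exact: cvg_cst.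
have [_ _ iwa] := hw a; have [_ _ iwb] := hw b.
set K := C * \prod_(j <- s) w j (v j).
have hb x y : `|h (x, y)| <= K * w a x * w b y.
  rewrite (le_trans (bF _)) // !big_cons upd_same upd_neq // upd_same.
  rewrite !prod_weight_upd // /K le_eqVlt; apply/orP; left; apply/eqP.
  by ring.
have ih : (mu \x mu)%E.-integrable setT (EFin \o h).
  apply/integrable12ltyP; first exact/measurable_EFinP.
  apply: (@le_lt_trans _ _ (\int[mu]_x ((K * \int[mu]_y w b y) * w a x)%:E)%E).
    apply: ge0_le_integral => //.
    - by move=> x _; apply: integral_ge0.
    - have mah : measurable_fun setT (abse \o (EFin \o h)).
        by apply: measurableT_comp => //; exact/measurable_EFinP.
      exact: (@measurable_fun_fubini_tonelli_F _ _ _ _ _ mu _ mah (fun _ => abse_ge0 _)).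
    - apply/measurable_EFinP/measurable_funM => //.
      by apply: continuous_measurableT; case: (hw a).
    move=> x _; rewrite mulrAC EFinM.
    have -> : ((\int[mu]_y w b y)%:E = \int[mu]_y (w b y)%:E)%E.
      by rewrite /Rintegral fineK //; exact: (integrable_fin_num measurableT iwb).
    rewrite -integralZl //; apply: ge0_le_integral => //.
    - exact: (measurableT_comp (@abse_measurable _ setT) (measurable_int _ (ib x))).
    - apply/measurable_EFinP/measurable_funM => //.
      by apply: continuous_measurableT; case: (hw b).
    - by move=> y _; rewrite /= lee_fin; exact: hb.
  have := integrableZl measurableT (K * \int[mu]_y w b y) iwa.
  move=> /(integrable_fin_num measurableT); rewrite fin_num_abs => /(le_lt_trans _); apply.
  by rewrite (le_trans _ (lee_abs _)).
have := Fubini ih; rewrite /h /=.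
rewrite /Rintegral => E; congr fine.
transitivity (\int[mu]_x \int[mu]_y (F (upd (upd v a x) b y))%:E)%E.
  apply: eq_integral => x _; rewrite fineK //.
  exact: (integrable_fin_num measurableT (ib x)).
rewrite E; apply: eq_integral => y _; rewrite fineK; last first.
  exact: (integrable_fin_num measurableT (ia y)).
by apply: eq_integral => x _; rewrite updC.
Qed.

Lemma Iop_iints C k s r F : uniq (k :: s ++ r) -> good w C (k :: s ++ r) F ->
  Iop k (iints s F) = iints s (Iop k F).
Proof.
elim: s r => [//|a s IH] r u gF /=.
have p : perm_eq (k :: a :: s ++ r) (s ++ [:: k, a & r]).
  by rewrite -[k :: _]/([:: k; a] ++ (s ++ r)) perm_catCA.
have p' : perm_eq (k :: a :: s ++ r) (k :: s ++ a :: r).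
  by rewrite perm_cons -(cat1s a) perm_catCA.
have u1 : uniq (s ++ [:: k, a & r]) by rewrite -(perm_uniq p).
rewrite (@Iop_swap (C * \prod_(k <- s) \int[mu]_x w k x) k a r).
- congr Iop; apply: (IH (a :: r)); last exact: good_perm gF.
  by rewrite -(perm_uniq p').
- by move: u1; rewrite cat_uniq => /and3P[].
- by apply: good_iints => //; exact: good_perm gF.
Qed.

(** Brings any coordinate to the innermost place, where a one-dimensional substitution can be made
    with all the others frozen. *)
Lemma iints_innermost C s1 s2 k F : uniq (s1 ++ k :: s2) -> good w C (s1 ++ k :: s2) F ->
  iints (s1 ++ k :: s2) F = iints (s1 ++ s2) (Iop k F).
Proof.
move=> u gF; rewrite /iints !foldr_cat /= -/(iints s2 F) -/(iints s2 (Iop k F)).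
have p : perm_eq (s1 ++ k :: s2) (k :: s2 ++ s1) by rewrite perm_catC.
by rewrite (@Iop_iints C k s2 s1) ?(perm_uniq p) -?(perm_uniq p) //; exact: good_perm gF.
Qed.

Lemma iints_linear C D s r (a b : R) F G v : uniq (s ++ r) ->
  good w C (s ++ r) F -> good w D (s ++ r) G ->
  iints s (fun v => a * F v + b * G v) v = a * iints s F v + b * iints s G v.
Proof.
elim: s r v => [//|k s IH] r v u gF gG /=.
have p : perm_eq (k :: s ++ r) (s ++ k :: r) by rewrite -cat1s perm_catCA.
have u1 : uniq (s ++ k :: r) by rewrite -(perm_uniq p).
have kr : k \notin r by move: u1; rewrite cat_uniq => /and3P[_ _ /= /andP[]].
have gF1 := good_perm p gF; have gG1 := good_perm p gG.
have iF := good_integrable v kr (good_iints u1 gF1).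
have iG := good_integrable v kr (good_iints u1 gG1).
rewrite /Iop; under eq_Rintegral do rewrite (IH (k :: r)) //.
rewrite RintegralD // ?RintegralZl //.
  by have := integrableZl measurableT a iF.
by have := integrableZl measurableT b iG.
Qed.

Lemma iints_dominated_cvg C s r (F_ : nat -> (nat -> R) -> R) F : uniq (s ++ r) ->
  (forall n, good w C (s ++ r) (F_ n)) -> good w C (s ++ r) F ->
  (forall v, F_ n v @[n --> \oo] --> F v) ->
  forall v, iints s (F_ n) v @[n --> \oo] --> iints s F v.
Proof.
move=> + + + FF; elim: s r => [//|k s IH] r u gF_ gF v /=.
have p : perm_eq (k :: s ++ r) (s ++ k :: r) by rewrite -cat1s perm_catCA.
have u1 : uniq (s ++ k :: r) by rewrite -(perm_uniq p).
have kr : k \notin r by move: u1; rewrite cat_uniq => /and3P[_ _ /= /andP[]].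
have gI_ n := good_iints u1 (good_perm p (gF_ n)).
have gI := good_iints u1 (good_perm p gF).
move: gI_ gI; set K := (C * _) => gI_ gI; have [_ _ iw] := hw k.
apply: (@Rintegral_dominated_cvg _ _ _ (fun x => (K * \prod_(j <- r) w j (v j)) * w k x)).
- by move=> n; have [c _] := gI_ n; apply: continuous_measurableT; exact: seqcont_upd.
- by have [c _] := gI; apply: continuous_measurableT; exact: seqcont_upd.
- move=> x; apply: (IH (k :: r)) => //; last exact: good_perm gF.
  by move=> n; exact: good_perm (gF_ n).
- have := integrableZl measurableT (K * \prod_(j <- r) w j (v j)) iw.
  by congr (mu.-integrable setT _); apply/funext => x /=; rewrite EFinM.
- move=> n x; have [_ b] := gI_ n.
  rewrite (le_trans (b _)) // big_cons upd_same prod_weight_upd //.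
  by rewrite mulrCA mulrC.
Qed.

(** Each partial integral is continuous and non-negative, so it vanishes for every value of its
    outer coordinate; the coordinates of [v'] are fixed one after the other. *)
Lemma iints_eq0 C s r F v v' : uniq (s ++ r) -> good w C (s ++ r) F ->
  (forall v, 0 <= F v) -> iints s F v = 0 ->
  (forall j, j \notin s -> v' j = v j) -> F v' = 0.
Proof.
move=> + + F0; elim: s r v => [|k s IH] r v u gF /= I0 vv'.
  by rewrite (_ : v' = v) //; apply/funext => j; exact: vv'.
have p : perm_eq (k :: s ++ r) (s ++ k :: r) by rewrite -cat1s perm_catCA.
have u1 : uniq (s ++ k :: r) by rewrite -(perm_uniq p).
have kr : k \notin r by move: u1; rewrite cat_uniq => /and3P[_ _ /= /andP[]].
have gI := good_iints u1 (good_perm p gF); have [cI _] := gI.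
have := Rintegral_eq0_continuous (@seqcont_upd _ v k cI) _ (good_integrable v kr gI) I0.
move=> /(_ (fun x => iints_ge0 _ _ F0)) /(_ (v' k)) H.
apply: (IH (k :: r) (upd v k (v' k))) => //; first exact: good_perm gF.
move=> j js; rewrite /upd; case: eqP => [->//|/eqP jk].
by apply: vv'; rewrite inE negb_or jk.
Qed.

Definition affine (s : seq nat) (a v : nat -> R) (e : R) : nat -> R :=
  fun j => if j \in s then a j + e * v j else v j.

Lemma iints_comp_upd s k (g : R -> R) F v : k \notin s ->
  iints s F (upd v k (g (v k))) = iints s (fun v => F (upd v k (g (v k)))) v.
Proof.
elim: s v => [//|j s IH] v; rewrite inE negb_or => /andP[kj ks] /=.
apply: eq_Rintegral => x _; rewrite -IH //; congr (iints s F _).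
by rewrite updC // (@upd_neq v j x k).
Qed.

Lemma iints_affine C s r (a : nat -> R) (e : R) F v : 0 < e -> uniq (s ++ r) ->
  good w C (s ++ r) F -> (forall v, 0 <= F v) ->
  iints s F v = e ^+ size s * iints s (fun v => F (affine s a v e)) v.
Proof.
move=> e0 + + F0; elim: s r v => [|k s IH] r v u gF /=; first by rewrite mul1r.
have p : perm_eq (k :: s ++ r) (s ++ k :: r) by rewrite -cat1s perm_catCA.
have u1 : uniq (s ++ k :: r) by rewrite -(perm_uniq p).
have kr : k \notin r by move: u1; rewrite cat_uniq => /and3P[_ _ /= /andP[]].
have ks : k \notin s by move: u => /= /andP[]; rewrite mem_cat negb_or => /andP[].
have gI := good_iints u1 (good_perm p gF); have [cI _] := gI.
rewrite /Iop.
have [iI ->] := Rintegral_affine (a k) e0 (@seqcont_upd _ v k cI)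
  (fun x => iints_ge0 _ _ F0) (good_integrable v kr gI).
rewrite exprS -mulrA; congr (_ * _).
have E x : iints s F (upd v k (a k + e * x)) =
    e ^+ size s * iints s (fun v => F (affine (k :: s) a v e)) (upd v k x).
  rewrite (IH (k :: r)) //; last exact: good_perm gF.
  congr (_ * _).
  have := @iints_comp_upd s k (fun x => a k + e * x)
    (fun v => F (affine s a v e)) (upd v k x) ks.
  rewrite upd_same {1}/upd => H.
  rewrite -[LHS]/(iints s (fun v => F (affine s a v e)) _).
  rewrite (_ : upd v k (a k + e * x) = upd (upd v k x) k (a k + e * x)); last first.
    by apply/funext => j; rewrite /upd; case: eqP.
  rewrite H; congr iints; apply/funext => z; congr F.
  apply/funext => j; rewrite /affine /upd inE.
  by have [->|//] := eqVneq j k; rewrite (negbTE ks).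
under eq_Rintegral do rewrite E.
rewrite RintegralZl //.
have en : e ^+ size s != 0 by rewrite expf_neq0 // gt_eqF.
have := integrableZl measurableT (e ^+ size s)^-1 iI.
by congr (mu.-integrable setT _); apply/funext => x /=; rewrite E -EFinM mulKf.
Qed.

End Weights.

(** Since [phi] ignores coordinate i, the substitution is a translation once that coordinate is
    innermost. Two families of weights occur because the integrand is dominated differently before
    and after it. *)
Lemma iints_shift w w' C C' s i (phi : (nat -> R) -> R) F :
  (forall k, weight (w k)) -> (forall k, weight (w' k)) ->
  uniq s -> i \in s -> (forall v x, phi (upd v i x) = phi v) ->
  (forall v, 0 <= F v) -> good w C s F ->
  good w' C' s (fun v => F (upd v i (v i + phi v))) ->
  iints s F = iints s (fun v => F (upd v i (v i + phi v))).
Proof.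
move=> hw hw' us /splitPr is_ phii F0; case: s / is_ us => s1 s2 us gF gG.
rewrite (iints_innermost hw us gF) (iints_innermost hw' us gG); congr iints.
have p : perm_eq (s1 ++ i :: s2) (i :: s1 ++ s2) by rewrite -(cat1s i) perm_catCA.
have is12 : i \notin s1 ++ s2 by move: us; rewrite (perm_uniq p) /= => /andP[].
apply/funext => v; have [cF _] := gF.
have [_ E] := Rintegral_affine (phi v) ltr01 (@seqcont_upd _ v i cF)
  (fun x => F0 _) (good_integrable hw v is12 (good_perm p gF)).
rewrite /Iop E mul1r; apply: eq_Rintegral => x _; congr F.
rewrite phii upd_same mul1r addrC.
by apply/funext => j; rewrite /upd; case: eqP.
Qed.

End Iterated.

(** * Gaussians as limits of products of cosines *)

Section Limits.
Variable R : realType.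
Local Notation mu := (@lebesgue_measure R).

Lemma weight_normal_pdf (m s : R) : s != 0 -> weight (normal_pdf m s).
Proof.
move=> s0; split; first exact: continuous_normal_pdf.
  by move=> x; exact: normal_pdf_ge0.
exact: integrable_normal_pdf.
Qed.

Lemma weight_gauss (c a : R) : 0 < c -> weight (fun x => expR (- (c * (x - a) ^+ 2))).
Proof.
(* The standard deviation whose variance is 1 / (2 c), which turns the function into a multiple of a
   normal density. *)
move=> c0; pose s : R := Num.sqrt (c *+ 2)^-1.
have s0 : s != 0 by rewrite gt_eqF // sqrtr_gt0 invr_gt0 mulrn_wgt0.
have E : (fun x => expR (- (c * (x - a) ^+ 2))) =
    (fun x => (normal_peak s)^-1 * normal_pdf a s x).
  apply/funext => x; rewrite normal_pdfE // mulKf ?gt_eqF ?normal_peak_gt0 //.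
  rewrite /normal_fun sqr_sqrtr ?invr_ge0 ?mulrn_wge0 ?(ltW c0) //.
  congr expR; rewrite -mulr_natr -[in RHS]mulr_natr invfM.
  by field; rewrite gt_eqF.
rewrite E; have [cn n0 intn] := weight_normal_pdf a s0; split.
- by move=> x; apply: cvgM; [exact: cvg_cst|exact: cn].
- by move=> x; rewrite mulr_ge0 // invr_ge0 normal_peak_ge0.
- have := integrableZl measurableT (normal_peak s)^-1 intn.
  by congr (mu.-integrable setT _); apply/funext => x /=; rewrite EFinM.
Qed.

Lemma cos_half (x : R) : cos x = 1 - sin (x / 2) ^+ 2 *+ 2.
Proof.
have {1}-> : x = x / 2 *+ 2 by rewrite -mulr_natr divfK.
by rewrite cos_mulr2n; have := cos2Dsin2 (x / 2); lra.
Qed.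

(** By the mean value theorem sin y = y cos c with 0 < c < y. The upper bound follows from cos c <=
    1, and the lower one from cos c = 1 - 2 sin^2 (c / 2) >= 1 - c^2 / 2. *)
Lemma sin_bounds (y : R) : 0 <= y -> y <= 1 -> y - y ^+ 3 / 2 <= sin y <= y.
Proof.
rewrite le_eqVlt => /predU1P[<-|y0 y1]; first by rewrite sin0 expr0n /= mul0r subr0 lexx.
have up (x : R) : 0 < x -> x <= 1 -> 0 <= sin x <= x.
  move=> x0 x1.
  have [c] := @MVT R sin cos 0 x x0 (fun x _ => is_derive_sin x) (continuous_subspaceT (@continuous_sin R)).
  rewrite in_itv /= sin0 !subr0 => /andP[c0 cx] ->.
  have cp : c <= pi / 2.
    apply: (le_trans (ltW (lt_le_trans cx x1))).
    by rewrite ler_pdivlMr // mul1r pi_ge2.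
  have cc : 0 <= cos c.
    rewrite cos_ge0_pihalf // cp andbT (le_trans _ (ltW c0)) //.
    by rewrite oppr_le0 divr_ge0 // pi_ge0.
  apply/andP; split; first by rewrite mulr_ge0 // ltW.
  by rewrite ler_piMl ?(ltW x0) // cos_le1.
have /andP[_ ->] := up y y0 y1; rewrite andbT.
have [c] := @MVT R sin cos 0 y y0 (fun x _ => is_derive_sin x) (continuous_subspaceT (@continuous_sin R)).
rewrite in_itv /= sin0 !subr0 => /andP[c0 cy] ->.
have h : 0 <= sin (c / 2) <= c / 2.
  apply: up; first by rewrite divr_gt0.
  by rewrite ler_pdivrMr // mul1r (le_trans (ltW (lt_le_trans cy y1))) // ler1n.
rewrite cos_half.
case/andP: h => h0 h1; have h2 : sin (c / 2) ^+ 2 <= (c / 2) ^+ 2 by rewrite ler_sqr ?nnegrE ?divr_ge0 // ltW.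
have h3 : c ^+ 2 <= y ^+ 2 by rewrite ler_sqr ?nnegrE ltW.
rewrite [_ ^+ 3]exprS; nra.
Qed.

(** Both functions lie between 1 - x^2 / 2 and 1 - x^2 / 2 + x^4 / 4. *)
Lemma cos_expR_close (x : R) : `|x| <= 1 -> `|cos x - expR (- (x ^+ 2 / 2))| <= x ^+ 4.
Proof.
move=> x1; have -> : cos x = cos `|x|.
  by have [_|_] := ger0P x; rewrite ?cosN.
rewrite -(@real_normK _ x) ?num_real // [x ^+ 4](_ : _ = `|x| ^+ 4); last first.
  by rewrite -[4%N]/((2 * 2)%N) !exprM real_normK // num_real.
move: (normr_ge0 x) x1; move: `|x| => {}x x0 x1.
have /andP[s1 s2] : x / 2 - (x / 2) ^+ 3 / 2 <= sin (x / 2) <= x / 2.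
  by apply: sin_bounds; lra.
rewrite cos_half.
have e1 : 1 - x ^+ 2 / 2 <= expR (- (x ^+ 2 / 2)).
  by have := expR_ge1Dx (- (x ^+ 2 / 2)).
(* With y = x^2 / 2, exp (- y) <= 1 / (1 + y) <= 1 - y + y^2, because (1 - y + y^2) (1 + y) = 1 +
   y^3. *)
have e2 : expR (- (x ^+ 2 / 2)) <= 1 - x ^+ 2 / 2 + (x ^+ 2 / 2) ^+ 2.
  rewrite expRN; have h := expR_ge1Dx (x ^+ 2 / 2).
  have y0 : 0 <= x ^+ 2 / 2 by rewrite divr_ge0 // sqr_ge0.
  move: (x ^+ 2 / 2) y0 h => y y0 h.
  have p : 0 < expR y by exact: expR_gt0.
  rewrite -[leLHS]mul1r ler_pdivrMr //.
  have : (1 - y + y ^+ 2) * (1 + y) <= (1 - y + y ^+ 2) * expR y.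
    by rewrite ler_wpM2l //; nra.
  nra.
set s := sin _ in s1 s2 *.
have l0 : 0 <= x / 2 - (x / 2) ^+ 3 / 2.
  rewrite exprS; have : 0 <= x ^+ 2 <= 1 by rewrite sqr_ge0 expr_le1.
  nra.
have s0 : 0 <= s := le_trans l0 s1.
have s3 : (x / 2 - (x / 2) ^+ 3 / 2) ^+ 2 <= s ^+ 2.
  by rewrite ler_sqr ?nnegrE.
have s4 : s ^+ 2 <= (x / 2) ^+ 2.
  by rewrite ler_sqr ?nnegrE // divr_ge0.
have s5 : x ^+ 2 / 4 - x ^+ 4 / 16 <= (x / 2 - (x / 2) ^+ 3 / 2) ^+ 2.
  have : 0 <= ((x / 2) ^+ 3 / 2) ^+ 2 by exact: sqr_ge0.
  have -> : (x / 2 - (x / 2) ^+ 3 / 2) ^+ 2 =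
    x ^+ 2 / 4 - x ^+ 4 / 16 + ((x / 2) ^+ 3 / 2) ^+ 2 by field.
  lra.
have x40 : 0 <= x ^+ 4 by rewrite exprn_ge0.
have E4 : (x ^+ 2 / 2) ^+ 2 = x ^+ 4 / 4 by field.
have E2 : (x / 2) ^+ 2 = x ^+ 2 / 4 by field.
rewrite ler_norml; apply/andP; split; rewrite mulr2n; lra.
Qed.

Lemma exprn_dist_le (u v : R) N : `|u| <= 1 -> `|v| <= 1 ->
  `|u ^+ N - v ^+ N| <= N%:R * `|u - v|.
Proof.
move=> u1 v1; elim: N => [|N IH]; first by rewrite subrr normr0 mul0r.
have -> : u ^+ N.+1 - v ^+ N.+1 = u * (u ^+ N - v ^+ N) + (u - v) * v ^+ N.
  by rewrite !exprS; ring.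
rewrite (le_trans (ler_normD _ _)) // !normrM normrX -addn1 natrD mulrDl mul1r.
apply: lerD.
  by rewrite (le_trans _ IH) // ler_piMl.
by rewrite ler_piMr // exprn_ile1.
Qed.

(** The limit is itself the (N + 1)-th power of exp (- x_N^2 / 2) with x_N = a / sqrt (N + 1), so
    the distance is at most (N + 1) x_N^4 = a^4 / (N + 1). *)
Lemma cos_pow_cvg (a : R) :
  cos (a / Num.sqrt N.+1%:R) ^+ N.+1 @[N --> \oo] --> expR (- (a ^+ 2 / 2)).
Proof.
pose x (N : nat) := a / Num.sqrt N.+1%:R : R.
have x2 N : x N ^+ 2 = a ^+ 2 / N.+1%:R by rewrite expr_div_n sqr_sqrtr.
have c0 (K : R) : K / N.+1%:R @[N --> \oo] --> 0.
  rewrite -[X in _ --> X](mulr0 K); apply: cvgM; first exact: cvg_cst.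
  exact: cvg_harmonic.
apply/cvgrPdist_le => e e0.
near=> N.
have n0 : N.+1%:R != 0 :> R by rewrite pnatr_eq0.
have -> : expR (- (a ^+ 2 / 2)) = expR (- (x N ^+ 2 / 2)) ^+ N.+1.
  by rewrite -expRM_natl x2; congr expR; field.
rewrite distrC (le_trans (exprn_dist_le _ _ _)) //.
- by rewrite ler_norml cos_geN1 cos_le1.
- rewrite ger0_norm ?expR_ge0 // -expR0 ler_expR oppr_le0 divr_ge0 //.
  exact: sqr_ge0.
rewrite -/(x N); apply: (@le_trans _ _ (N.+1%:R * x N ^+ 4)).
  rewrite ler_wpM2l // cos_expR_close //.
  rewrite -(@ler_sqr _ `|x N| 1) ?nnegrE // real_normK ?num_real // x2 expr1n.
  near: N; apply: (cvgr_le 0) => //; exact: c0.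
rewrite -[4%N]/((2 * 2)%N) exprM x2.
have -> : N.+1%:R * (a ^+ 2 / N.+1%:R) ^+ 2 = a ^+ 4 / N.+1%:R by field.
near: N; apply: (cvgr_le 0) => //; exact: c0.
Unshelve. all: end_near. Qed.
End Limits.

(** * Recovery of the layers from the energy *)

Section Height.
Variables (n : nat) (G : rel 'I_n).
Hypothesis aG : acyclic G.

(** The index of the layer of i. Lengths up to n suffice, as a path in an acyclic graph repeats no
    node. *)
Definition height (i : 'I_n) : nat :=
  \max_(k < n.+1 | [exists t : k.-tuple 'I_n, path G i t]) k.

Lemma acyclic_path_uniq i s : path G i s -> uniq (i :: s).
Proof.
elim: s i => [//|j s IH] i /= /andP[Gij pj]; rewrite -/(uniq (j :: s)) IH // andbT.
apply/negP => ijs; have /negP := aG Gij; apply; exact: (path_connect pj ijs).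
Qed.

Lemma path_le_height i s : path G i s -> (size s <= height i)%N.
Proof.
move=> ps; have sn : (size s < n.+1)%N.
  have /card_uniqP := acyclic_path_uniq ps => /= E.
  by rewrite ltnW // -{2}(card_ord n) -E ltnS max_card.
apply: (@leq_bigmax_cond _ (fun k : 'I_n.+1 => [exists t : k.-tuple 'I_n, path G i t])
  (fun k : 'I_n.+1 => k : nat) (Ordinal sn)).
by apply/existsP; exists (in_tuple s).
Qed.

Lemma height_path i : exists2 s, path G i s & size s = height i.
Proof.
rewrite /height; have [|k /existsP[t pt] ->] := @eq_bigmax_cond _
  (fun k : 'I_n.+1 => [exists t : k.-tuple 'I_n, path G i t]) (fun k : 'I_n.+1 => k : nat).
  by apply/card_gt0P; exists ord0; apply/existsP; exists [tuple].
by exists t => //; rewrite size_tuple.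
Qed.

Lemma height_edge i j : G i j -> (height j < height i)%N.
Proof.
move=> Gij; have [s ps <-] := height_path j.
by apply: (@path_le_height i (j :: s)); rewrite /= Gij.
Qed.

Lemma height_child i : (0 < height i)%N -> exists2 j, G i j & height i = (height j).+1.
Proof.
have [[|j s] /= ps E] := height_path i; first by rewrite -E.
move: ps => /andP[Gij pj] _; exists j => //.
by apply/eqP; rewrite eqn_leq height_edge // -E ltnS path_le_height.
Qed.

(** A longest path ends in a leaf, since otherwise it could be prolonged. *)
Lemma in_layer_height k i : in_layer G k i -> k = height i.
Proof.
move=> [[s [ps <- _]] mx]; apply/eqP; rewrite eqn_leq path_le_height //=.
have [s' ps' E] := height_path i; rewrite -E; apply: mx => // j.
apply/negP => Gl; have := @path_le_height i (rcons s' j).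
by rewrite rcons_path ps' Gl size_rcons E ltnn => /(_ isT).
Qed.

End Height.

(** * Second differences along a direction *)

Section SecondDifference.
Variables (R : realType) (n : nat).
Implicit Types (F : 'cV[R]_n -> R) (b z : 'cV[R]_n) (t : R).

Definition diff2 F b t z := F (z + t *: b) + F (z - t *: b) - 2 * F z.

(** Vanishing second differences make the increments of F along b independent of the starting point
    on the line, so the derivative along b is constant on it. *)
Lemma derive2_diff2_eq0 F b : (forall t z, diff2 F b t z = 0) ->
  forall z, 'D_b ('D_b F) z = 0.
Proof.
move=> F0.
(* Second differences centred at the midpoint (s + t) / 2 with half-steps (s + t) / 2 and (s - t) /
   2 compare the pair s + t, 0 with the pair s, t. *)
have J z s t : F (z + (s + t) *: b) - F (z + s *: b) = F (z + t *: b) - F z.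
  have := F0 ((s + t) / 2) (z + ((s + t) / 2) *: b).
  have := F0 ((s - t) / 2) (z + ((s + t) / 2) *: b).
  have EP x y : z + x *: b + y *: b = z + (x + y) *: b by rewrite -addrA -scalerDl.
  have EM x y : z + x *: b - y *: b = z + (x - y) *: b by rewrite -addrA -scalerBl.
  rewrite /diff2 !EP !EM.
  rewrite (_ : (s + t) / 2 + (s - t) / 2 = s); last by lra.
  rewrite (_ : (s + t) / 2 - (s - t) / 2 = t); last by lra.
  rewrite (_ : (s + t) / 2 + (s + t) / 2 = s + t); last by lra.
  by rewrite subrr scale0r addr0; lra.
have D z h : 'D_b F (z + h *: b) = 'D_b F z.
  apply: (congr1 (fun g : R -> R^o => lim (g @ 0^'))); apply/funext => k /=.
  have -> : k *: b + (z + h *: b) = z + (h + k) *: b.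
    by rewrite addrC -addrA -scalerDl.
  by rewrite J [k *: b + z]addrC.
move=> z; rewrite -[RHS](@lim_cst R^o (@Rhausdorff R) R (0^') _ 0).
apply: (congr1 (fun g : R -> R^o => lim (g @ 0^'))).
by apply/funext => k /=; rewrite [k *: b + z]addrC D subrr scaler0.
Qed.

Lemma diff2_sum (I : finType) (P : pred I) (F : I -> 'cV[R]_n -> R) b t z :
  diff2 (fun z => \sum_(i | P i) F i z) b t z = \sum_(i | P i) diff2 (F i) b t z.
Proof. by rewrite /diff2 mulr_sumr -big_split -sumrB. Qed.

End SecondDifference.

(** * Energies restricted to the upper layers and their flat directions *)

Section Residual.
Variables (R : realType) (n : nat) (G : rel 'I_n) (f : 'I_n -> 'cV[R]_n -> R)
  (sigma : 'I_n -> R).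
Hypothesis aG : acyclic G.
Hypothesis df : forall i, depends_only_on (fun j => G j i) (f i).
Hypothesis nlf : forall i, dir_nonlinear (fun j => G j i) (f i).
Hypothesis sigma0 : forall i, 0 < sigma i.
Implicit Types (b z : 'cV[R]_n) (t : R).

Definition residual i z := (z i 0 - f i z) ^+ 2 / sigma i ^+ 2.
Definition energy k z := \sum_(i | (k <= height G i)%N) residual i z.
Definition flat (F : 'cV[R]_n -> R) b := forall t z z', diff2 F b t z = diff2 F b t z'.

Lemma residual_ge0 i z : 0 <= residual i z.
Proof. by rewrite divr_ge0 // sqr_ge0. Qed.

Lemma diff2_residual_const i b t z : (forall j, G j i -> b j 0 = 0) ->
  diff2 (residual i) b t z = 2 * (t * b i 0) ^+ 2 / sigma i ^+ 2.
Proof.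
move=> b0; rewrite /diff2 /residual !mxE.
have -> : f i (z + t *: b) = f i z by apply: df => j /b0; rewrite !mxE => ->; rewrite mulr0 addr0.
have -> : f i (z - t *: b) = f i z by apply: df => j /b0; rewrite !mxE => ->; rewrite mulr0 subr0.
by field; rewrite gt_eqF.
Qed.

(** If the part of b on the parents of i were non-zero, its normalisation would be a unit direction
    of vanishing second derivative; the other entries of b do not affect [f i]. *)
Lemma diff2_eq0_parents i (b : 'cV[R]_n) : (forall t z, diff2 (f i) b t z = 0) ->
  forall j, G j i -> b j 0 = 0.
Proof.
move=> d0; pose S := \sum_(j | G j i) b j 0 ^+ 2.
have S0 : 0 <= S by apply: sumr_ge0 => j _; exact: sqr_ge0.
move: S0; rewrite le_eqVlt => /predU1P[S0 j Gji|S0].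
  apply/eqP; rewrite -sqrf_eq0; apply/eqP.
  have /psumr_eq0P H : forall j, G j i -> 0 <= b j 0 ^+ 2 by move=> *; exact: sqr_ge0.
  exact: H.
pose r := Num.sqrt S; have r0 : 0 < r by rewrite sqrtr_gt0.
pose c : 'cV[R]_n := \col_j (if G j i then b j 0 / r else 0).
case: (@nlf i); exists c; split.
- by move=> j /negbTE Gji; rewrite mxE Gji.
- rewrite (bigID (fun j => G j i)) /= [X in _ + X]big1 ?addr0; last first.
    by move=> j /negbTE Gji; rewrite mxE Gji expr0n.
  under eq_bigr => j Gji do rewrite mxE Gji expr_div_n.
  by rewrite -mulr_suml sqr_sqrtr ?divff ?gt_eqF // ltW.
- apply: derive2_diff2_eq0 => t z; rewrite -(d0 (t / r) z) /diff2.
  congr (_ + _ - _); apply: df => j Gji; rewrite !mxE Gji; by field; rewrite gt_eqF.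
Qed.

Lemma energy_flatP k b : flat (energy k) b <-> (forall j, (k < height G j)%N -> b j 0 = 0).
Proof.
split=> [fl|b0]; last first.
  move=> t z z'; rewrite !diff2_sum; apply: eq_bigr => i ki.
  have bi j : G j i -> b j 0 = 0 by move=> /(height_edge aG) ij; apply: b0; exact: leq_trans ij.
  by rewrite !diff2_residual_const.
pose P i := (k <= height G i)%N && [exists j, G j i && (b j 0 != 0)].
case: (pickP P) => [i0 Pi0|P0]; last first.
  (* A node j above layer k has a child of layer at least k, and [P0] at that child forces b_j =
     0. *)
  move=> j kj; have [i Gji E] := height_child aG (leq_ltn_trans (leq0n _) kj).
  apply/eqP; rewrite -[_ == _]negbK; apply/negP => bj.
  have := P0 i; rewrite /P -ltnS -E kj /= => /existsP; apply.
  by exists j; rewrite Gji.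
case: (arg_minnP (height G) Pi0) => i /andP[ki /existsP[j /andP[Gji bj]]] imin.
suff d0 : forall t z, diff2 (f i) b t z = 0.
  by rewrite (diff2_eq0_parents d0 Gji) eqxx in bj.
(* A unit step in z_i changes only the term of i in the second difference. A child of i lies in a
   lower layer, so by minimality none of its parents moves, and the remaining nodes do not have i as
   a parent. *)
move=> t z; pose z' := z + ecv R i.
have z'i x i' : ~~ G i i' -> f i' (x + ecv R i) = f i' x.
  move=> Gii'; apply: df => l Gli'; rewrite !mxE.
  case: eqP => [E|_]; last by rewrite addr0.
  by rewrite -E Gli' in Gii'.
have := fl t z z'; rewrite !diff2_sum (bigD1 i) // [RHS](bigD1 i) //=.
have -> : \sum_(i' | (k <= height G i')%N && (i' != i)) diff2 (residual i') b t z =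
    \sum_(i' | (k <= height G i')%N && (i' != i)) diff2 (residual i') b t z'.
  apply: eq_bigr => i' /andP[ki' i'i]; have [Gii'|Gii'] := boolP (G i i').
    have bi' l : G l i' -> b l 0 = 0.
      move=> Gli'; apply/eqP; rewrite -[_ == _]negbK; apply/negP => bl.
      have Pi' : P i' by rewrite /P ki'; apply/existsP; exists l; rewrite Gli'.
      by have := imin _ Pi'; rewrite leqNgt (height_edge aG).
    by rewrite !diff2_residual_const.
  rewrite /diff2 /residual /z' ![z + ecv R i + _]addrAC !z'i //.
  by rewrite !mxE (negbTE i'i) !addr0.
move/addIr; rewrite /diff2 /residual /z' ![z + ecv R i + _]addrAC.
have Gii : ~~ G i i by apply/negP => Gii; have := height_edge aG Gii; rewrite ltnn.
rewrite !z'i //.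
rewrite !mxE eqxx => H.
have s0 : sigma i ^+ 2 != 0 by rewrite expf_neq0 // gt_eqF.
have : (0 : R) = 2 * (f i (z + t *: b) + f i (z - t *: b) - 2 * f i z) / sigma i ^+ 2.
  move/eqP: H; rewrite -subr_eq0 => /eqP <-.
  by rewrite mulr1n; field; rewrite gt_eqF.
by move/esym/eqP; rewrite !mulf_eq0 invr_eq0 (negbTE s0) pnatr_eq0 /= orbF => /eqP.
Qed.

(** Parents lie in strictly higher layers, so the residuals of layers at least k do not read the
    coordinates below layer k. *)
Lemma energy_shift k b z : (forall j, (k <= height G j)%N -> b j 0 = 0) ->
  energy k (z + b) = energy k z.
Proof.
move=> b0; apply: eq_bigr => i ki; rewrite /residual !mxE b0 // addr0.
rewrite (df (x := z + b) (y := z)) // => j /(height_edge aG) ij.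
by rewrite !mxE b0 ?addr0 // (leq_trans ki) // ltnW.
Qed.

Lemma energy_le k z : energy k.+1 z <= energy k z.
Proof.
rewrite /energy [leRHS](bigID (fun i => (k.+1 <= height G i)%N)) /=.
rewrite [X in _ <= X + _](eq_bigl (fun i => (k.+1 <= height G i)%N)).
  by rewrite lerDl sumr_ge0 // => i _; exact: residual_ge0.
by move=> i /=; rewrite andb_idl // => /ltnW.
Qed.

(** Setting each z_j of layer k to [f j z] cancels the residuals of that layer and leaves those
    above it unchanged. Thus [energy k.+1] is the minimum of [energy k] over translations by layers
    at most k. *)
Lemma energy_min k z : exists2 b : 'cV[R]_n, forall j, (k < height G j)%N -> b j 0 = 0 &
  energy k (z + b) = energy k.+1 z.
Proof.
pose b : 'cV[R]_n := \col_j (if height G j == k then f j z - z j 0 else 0).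
have b0 j : (k < height G j)%N -> b j 0 = 0 by move=> kj; rewrite mxE gtn_eqF.
exists b => //; rewrite -(energy_shift z b0) /energy.
rewrite (bigID (fun i => (k.+1 <= height G i)%N)) /= [X in _ + X]big1 ?addr0.
  by apply: eq_bigl => i; rewrite andb_idl // => /ltnW.
move=> i; rewrite -leqNgt andbC -eqn_leq => /eqP E; rewrite /residual !mxE E eqxx.
rewrite (df (x := z + b) (y := z)); first by rewrite addrC subrK subrr expr0n /= mul0r.
by move=> j /(height_edge aG); rewrite E => kj; rewrite mxE b0 ?addr0.
Qed.

End Residual.

(** * Comparison of the layers of two models *)

Section Layers.
Variables (R : realType) (n : nat).

(** The minimising translation of the first model is mapped by A to one that is admissible in the
    second, where the energy cannot fall below its minimum. *)
Lemma energy_step (G G0 : rel 'I_n) (f f0 : 'I_n -> 'cV[R]_n -> R) (sigma sigma0 : 'I_n -> R)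
    (A : 'M[R]_n) k :
  acyclic G -> acyclic G0 ->
  (forall i, depends_only_on (fun j => G j i) (f i)) ->
  (forall i, depends_only_on (fun j => G0 j i) (f0 i)) ->
  (forall z, energy G f sigma k z = energy G0 f0 sigma0 k (A *m z)) ->
  (forall b : 'cV[R]_n, (forall j, (k < height G j)%N -> b j 0 = 0) ->
    forall j, (k < height G0 j)%N -> (A *m b) j 0 = 0) ->
  forall z, energy G0 f0 sigma0 k.+1 (A *m z) <= energy G f sigma k.+1 z.
Proof.
move=> aG aG0 df df0 E Ab z.
have [b b0 <-] := energy_min sigma aG df k z.
rewrite E mulmxDr -(energy_shift sigma0 aG0 df0 (A *m z) (Ab _ b0)).
exact: energy_le.
Qed.

Section TwoModels.
Variables (G G0 : rel 'I_n) (f f0 : 'I_n -> 'cV[R]_n -> R) (sigma sigma0 : 'I_n -> R).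
Hypotheses (aG : acyclic G) (aG0 : acyclic G0).
Hypothesis df : forall i, depends_only_on (fun j => G j i) (f i).
Hypothesis df0 : forall i, depends_only_on (fun j => G0 j i) (f0 i).
Hypothesis nlf : forall i, dir_nonlinear (fun j => G j i) (f i).
Hypothesis nlf0 : forall i, dir_nonlinear (fun j => G0 j i) (f0 i).
Hypothesis sigma_gt0 : forall i, 0 < sigma i.
Hypothesis sigma0_gt0 : forall i, 0 < sigma0 i.
Variables A B : 'M[R]_n.
Hypotheses (AB : A *m B = 1%:M) (BA : B *m A = 1%:M).
Hypothesis E0 : forall z, energy G f sigma 0 z = energy G0 f0 sigma0 0 (A *m z).

Lemma flat_mulmx k (b : 'cV[R]_n) :
  (forall z, energy G f sigma k z = energy G0 f0 sigma0 k (A *m z)) ->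
  flat (energy G f sigma k) b <-> flat (energy G0 f0 sigma0 k) (A *m b).
Proof.
move=> E; have D t z : diff2 (energy G f sigma k) b t z =
    diff2 (energy G0 f0 sigma0 k) (A *m b) t (A *m z).
  by rewrite /diff2 !E mulmxDr mulmxBr -!scalemxAr.
split=> fl t z z'; last by rewrite !D.
rewrite -[z]mul1mx -[z']mul1mx -AB -!mulmxA -!D; exact: fl.
Qed.

Lemma energy_eq k z : energy G f sigma k z = energy G0 f0 sigma0 k (A *m z).
Proof.
elim: k z => [//|k IH] z.
have fP b := energy_flatP aG df nlf sigma_gt0 k b.
have fP0 b := energy_flatP aG0 df0 nlf0 sigma0_gt0 k b.
have fA b := flat_mulmx b IH.
apply/eqP; rewrite eq_le; apply/andP; split; last first.
  by apply: energy_step IH _ _ => // b /fP /fA /fP0.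
(* The reverse inequality is the same step for B with the two models exchanged. *)
have IHB z' : energy G0 f0 sigma0 k z' = energy G f sigma k (B *m z').
  by rewrite IH mulmxA AB mul1mx.
rewrite -[z in leLHS]mul1mx -BA -mulmxA.
apply: energy_step IHB _ _ => // b bP; apply/fP/fA.
by rewrite mulmxA AB mul1mx; apply/fP0.
Qed.

Lemma height_mulmx k (b : 'cV[R]_n) : (forall j, (k < height G j)%N -> b j 0 = 0) <->
  (forall j, (k < height G0 j)%N -> (A *m b) j 0 = 0).
Proof.
have fP := energy_flatP aG df nlf sigma_gt0 k b.
have fP0 := energy_flatP aG0 df0 nlf0 sigma0_gt0 k (A *m b).
have fA := flat_mulmx b (energy_eq k).
by split=> [/fP /fA /fP0|/fP0 /fA /fP].
Qed.

Lemma unitmx_perm (M : 'M[R]_n) : M \in unitmx -> exists s : 'S_n, forall i, M i (s i) != 0.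
Proof.
rewrite unitmxE unitfE => dM.
case: (pickP (fun s : 'S_n => [forall i, M i (s i) != 0])) => [s /forallP|H].
  by exists s.
case/eqP: dM; apply: big1 => s _.
have /negbT := H s; rewrite negb_forall => /existsP[i]; rewrite negbK => /eqP Mi.
by rewrite (bigD1 i) //= Mi mul0r mulr0.
Qed.

(** Column j of A is the image of the j-th basis vector, which is supported on layers at most that
    of j. *)
Lemma mulmx_entry_eq0 i j : (height G j < height G0 i)%N -> A i j = 0.
Proof.
move=> ji; have /height_mulmx /(_ i ji) : forall l, (height G j < height G l)%N -> ecv R j l 0 = 0.
  by move=> l; rewrite mxE; case: eqP => [->|//]; rewrite ltnn.
rewrite mxE (bigD1 j) //= mxE eqxx mulr1 big1 ?addr0 // => l /negbTE lj.
by rewrite mxE lj mulr0.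
Qed.

Lemma mulmx_inv_entry_eq0 i j : (height G0 j < height G i)%N -> B i j = 0.
Proof.
move=> ji.
have BE : forall l, (height G0 j < height G l)%N -> (B *m ecv R j) l 0 = 0.
  apply/height_mulmx => l jl; rewrite mulmxA AB mul1mx mxE.
  by move: jl; case: eqP => [->|//]; rewrite ltnn.
have := BE i ji.
rewrite mxE (bigD1 j) //= mxE eqxx mulr1 big1 ?addr0 // => l /negbTE lj.
by rewrite mxE lj mulr0.
Qed.

(** Non-zero entries of A along s give height G0 i <= height G (s i), and those of B along s' give
    the inequality the other way. Summed over all nodes, both total heights agree, so each
    inequality is an equality. *)
Lemma layer_perm : exists s : 'S_n,
  (forall i, A i (s i) != 0) /\ (forall i, height G0 i = height G (s i)).
Proof.
have [s As] : exists s : 'S_n, forall i, A i (s i) != 0.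
  by apply: unitmx_perm; have [] := mulmx1_unit AB.
have [s' Bs] : exists s : 'S_n, forall i, B i (s i) != 0.
  by apply: unitmx_perm; have [] := mulmx1_unit AB.
exists s; split => // i.
have h1 j : (height G0 j <= height G (s j))%N.
  by rewrite leqNgt; apply/negP => /mulmx_entry_eq0 /eqP; rewrite (negbTE (As j)).
have h2 j : (height G j <= height G0 (s' j))%N.
  by rewrite leqNgt; apply/negP => /mulmx_inv_entry_eq0 /eqP; rewrite (negbTE (Bs j)).
have S1 : (\sum_j height G (s j) = \sum_j height G j)%N by rewrite [RHS](reindex_inj (@perm_inj _ s)).
have S2 : (\sum_j height G0 (s' j) = \sum_j height G0 j)%N by rewrite [RHS](reindex_inj (@perm_inj _ s')).
have : (\sum_j height G0 j == \sum_j height G (s j))%N.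
  by rewrite eqn_leq leq_sum //= S1 -S2 leq_sum.
have := @leqif_sum _ predT (fun j => height G0 j == height G (s j)) (fun j => height G0 j)
  (fun j => height G (s j)) (fun j _ => leqif_eq (h1 j)).
by move=> [_ ->] /forall_inP /(_ i isT) /eqP.
Qed.

Lemma layer_decomposition : exists (s : 'S_n) (C : 'M[R]_n),
  [/\ forall i, C i i != 0,
      forall (i j : 'I_n) (k l : nat),
        in_layer G k i -> in_layer G l j -> (l < k)%N -> C i j = 0
    & A = perm_mx s *m C].
Proof.
(* Row s i of C is row i of A, so the entries A_(i, s i) become the diagonal. *)
have [s [As hs]] := layer_perm; exists s, (perm_mx s^-1 *m A).
have CE i j : (perm_mx s^-1 *m A) i j = A ((s^-1)%g i) j by rewrite -row_permE mxE.
split.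
- by move=> i; rewrite CE; have := As ((s^-1)%g i); rewrite permKV.
- move=> i j k l /(in_layer_height aG) -> /(in_layer_height aG) -> lk.
  by rewrite CE mulmx_entry_eq0 // hs permKV.
- by rewrite mulmxA -perm_mxM mulgV perm_mx1 mul1mx.
Qed.

End TwoModels.
End Layers.

(** * The density of the structural model *)

Section CoordinatewiseContinuity.
Variable R : realType.

(** The counterpart of [seqcont] for column vectors, so that continuity transfers to integrands
    through [colf]. *)
Definition coordcont m (g : 'cV[R]_m -> R) := forall (u : nat -> 'cV[R]_m) (z : 'cV[R]_m),
  (forall i, u N i 0 @[N --> \oo] --> z i 0) -> g (u N) @[N --> \oo] --> g z.

Lemma continuous_coordcont m (g : 'cV[R]_m -> R) : continuous g -> coordcont g.
Proof.
move=> cg u z uz; apply: (@cvg_comp _ _ _ u g _ (nbhs z)); last exact: cg.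
apply/cvg_ballP => e e0.
suff : \forall N \near \oo, forall i, ball (z i 0) e (u N i 0).
  by apply: filterS => N H; split => // i j; rewrite !ord1; exact: H.
by apply: filter_forall => i; move/cvg_ballP: (uz i); apply.
Qed.

Lemma cvg_mulmx m p (H : 'M[R]_(p, m)) (u : nat -> 'cV[R]_m) (z : 'cV[R]_m) :
  (forall i, u N i 0 @[N --> \oo] --> z i 0) ->
  forall i, (H *m u N) i 0 @[N --> \oo] --> (H *m z) i 0.
Proof.
move=> uz i; rewrite mxE (_ : (fun N => _) = (fun N => \sum_j H i j * u N j 0)); last first.
  by apply/funext => N; rewrite mxE.
apply: cvg_big; first by move=> x; exact: add_continuous.
by move=> j _; apply: cvgM; [exact: cvg_cst|exact: uz].
Qed.

Lemma cvg_prodr (I : Type) (r : seq I) (P : pred I) (f : I -> nat -> R) (l : I -> R) :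
  (forall i, P i -> f i N @[N --> \oo] --> l i) ->
  \prod_(i <- r | P i) f i N @[N --> \oo] --> \prod_(i <- r | P i) l i.
Proof.
move=> fl; apply: cvg_big => //.
by move=> x; apply: cvgM; [exact: cvg_fst|exact: cvg_snd].
Qed.

Lemma cvg_sumr (I : Type) (r : seq I) (P : pred I) (f : I -> nat -> R) (l : I -> R) :
  (forall i, P i -> f i N @[N --> \oo] --> l i) ->
  \sum_(i <- r | P i) f i N @[N --> \oo] --> \sum_(i <- r | P i) l i.
Proof.
by move=> fl; apply: cvg_big => //; move=> x; exact: add_continuous.
Qed.

End CoordinatewiseContinuity.

(** * Expectations over the Gaussian noise *)

Section Expectation.
Variables (R : realType) (n : nat) (sigma : 'I_n -> R).
Hypothesis sigma_gt0 : forall i, 0 < sigma i.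
Implicit Types (g h : 'cV[R]_n -> R).

Definition colf (v : nat -> R) : 'cV[R]_n := \col_i v i.

Lemma colf_cvg (u : nat -> nat -> R) v : (forall k, u N k @[N --> \oo] --> v k) ->
  forall i, colf (u N) i 0 @[N --> \oo] --> colf v i 0.
Proof.
move=> uv i; rewrite mxE (_ : (fun N => _) = (fun N => u N i)) //.
by apply/funext => N; rewrite mxE.
Qed.

(** The deviation 1 at indices k >= n is a placeholder: every natural number must carry a weight. *)
Definition noise_weight (k : nat) : R -> R :=
  normal_pdf 0 (if insub k is Some i then sigma i else 1).

Lemma noise_weightE (i : 'I_n) : noise_weight i = normal_pdf 0 (sigma i).
Proof. by rewrite /noise_weight valK. Qed.

Lemma weight_noise k : weight (noise_weight k).
Proof.
apply: weight_normal_pdf; case: insubP => [i _ _|_]; last exact: oner_neq0.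
by rewrite gt_eqF.
Qed.

Lemma prod_iota (F : nat -> R) : \prod_(k <- iota 0 n) F k = \prod_(i < n) F i.
Proof. by rewrite -(big_mkord xpredT) /index_iota subn0. Qed.

Let FE g := fun v : nat -> R => g (colf v) * \prod_(i < n) normal_pdf 0 (sigma i) (v i).

Lemma expectE g : gauss_expect sigma g = iints (iota 0 n) (FE g) (fun=> 0).
Proof. by rewrite -iintE. Qed.

Lemma good_expect C g : coordcont g -> (forall z, `|g z| <= C) ->
  good noise_weight C (iota 0 n ++ [::]) (FE g).
Proof.
move=> cg bg; rewrite cats0; split.
  move=> u v uv; apply: cvgM; first by apply: cg; exact: colf_cvg.
  apply: cvg_prodr => i _; apply: cvg_comp (uv i) _.
  by apply: continuous_normal_pdf; rewrite gt_eqF.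
move=> v; rewrite prod_iota /FE normrM (eq_bigr (fun i : 'I_n => noise_weight i (v i))).
  have p0 : 0 <= \prod_(i < n) noise_weight i (v i).
    by apply: prodr_ge0 => i _; exact: normal_pdf_ge0.
  by rewrite [`|\prod_(i < n) _|]ger0_norm // ler_wpM2r.
by move=> i _; rewrite noise_weightE.
Qed.

Let uI : uniq (iota 0 n ++ [::]). Proof. by rewrite cats0 iota_uniq. Qed.

Lemma expect_linear C D (a b : R) g h :
  coordcont g -> coordcont h -> (forall z, `|g z| <= C) -> (forall z, `|h z| <= D) ->
  gauss_expect sigma (fun z => a * g z + b * h z) =
  a * gauss_expect sigma g + b * gauss_expect sigma h.
Proof.
move=> cg ch bg bh; rewrite !expectE.
rewrite -(iints_linear weight_noise _ _ _ uI (good_expect cg bg) (good_expect ch bh)).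
by congr iints; apply/funext => v; rewrite /FE; ring.
Qed.

Lemma expect_cvg C (g_ : nat -> 'cV[R]_n -> R) g :
  (forall N, coordcont (g_ N)) -> coordcont g ->
  (forall N z, `|g_ N z| <= C) -> (forall z, `|g z| <= C) ->
  (forall z, g_ N z @[N --> \oo] --> g z) ->
  gauss_expect sigma (g_ N) @[N --> \oo] --> gauss_expect sigma g.
Proof.
move=> cg_ cg bg_ bg gg; rewrite expectE.
rewrite (_ : (fun N => _) = (fun N => iints (iota 0 n) (FE (g_ N)) (fun=> 0))); last first.
  by apply/funext => N; rewrite expectE.
apply: (iints_dominated_cvg weight_noise uI) => [N||v].
- exact: (good_expect (cg_ N) (bg_ N)).
- exact: good_expect cg bg.
- by apply: cvgM; [exact: gg|exact: cvg_cst].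
Qed.

Lemma expect_eq0 C g : coordcont g -> (forall z, 0 <= g z) -> (forall z, g z <= C) ->
  gauss_expect sigma g = 0 -> forall z, g z = 0.
Proof.
move=> cg g0 gC; rewrite expectE => E z.
pose v (k : nat) : R := if insub k is Some i then z i 0 else 0.
have vz : colf v = z by apply/colP => i; rewrite mxE /v valK.
have p0 (x : nat -> R) : 0 < \prod_(i < n) normal_pdf 0 (sigma i) (x i).
  apply: prodr_gt0 => i _; rewrite normal_pdfE ?gt_eqF // mulr_gt0 ?expR_gt0 //.
  by rewrite normal_peak_gt0 // gt_eqF.
have bg z' : `|g z'| <= C by rewrite ger0_norm.
have := iints_eq0 weight_noise uI (good_expect cg bg) _ E (v' := v).
move=> /(_ (fun x => mulr_ge0 (g0 _) (ltW (p0 x)))).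
have h j : j \notin iota 0 n -> v j = (fun=> 0) j.
  by rewrite mem_iota /= add0n => jn; rewrite /v insubN.
by move=> /(_ h) /eqP; rewrite /FE mulf_eq0 (gt_eqF (p0 v)) orbF vz => /eqP.
Qed.

End Expectation.

(** * Change of variables from the noise to the latent vector *)

Section StructuralModel.
Variables (R : realType) (n : nat) (G : rel 'I_n) (f : 'I_n -> 'cV[R]_n -> R)
  (sigma : 'I_n -> R).
Hypothesis aG : acyclic G.
Hypothesis df : forall i, depends_only_on (fun j => G j i) (f i).
Hypothesis cf : forall i, coordcont (f i).
Hypothesis sigma_gt0 : forall i, 0 < sigma i.

Lemma height_lt i : (height G i < n)%N.
Proof.
have [s ps <-] := height_path G i.
have /card_uniqP := acyclic_path_uniq aG ps => /= E.
by have := max_card (mem (i :: s)); rewrite card_ord E.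
Qed.

(** Nodes settle from the sources downwards: after m iterations all those of height at least n - m
    are final, since their parents are higher and settled one step earlier. *)
Lemma sem_iter_stable (e : 'cV[R]_n) m i : (n <= height G i + m)%N ->
  iter m.+1 (sem_step f e) 0 i 0 = iter m (sem_step f e) 0 i 0.
Proof.
elim: m i => [|m IH] i; first by rewrite addn0 leqNgt height_lt.
move=> h; rewrite iterS mxE [RHS]mxE; congr (_ + _); apply: df => j Gji.
apply: IH; apply: (leq_trans h); rewrite addnS -addSn leq_add2r.
exact: height_edge.
Qed.

Lemma semE (e : 'cV[R]_n) i : sem f e i 0 = f i (sem f e) + e i 0.
Proof. by rewrite -[in LHS]sem_iter_stable ?leq_addl // iterS mxE. Qed.

Definition ancestral (S : {set 'I_n}) := forall i j, G j i -> i \in S -> j \in S.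

(** Relative to an ancestral set, because midway through the change of variables the equations are
    known only on the nodes already treated. *)
Lemma sem_unique (S : {set 'I_n}) (e z : 'cV[R]_n) : ancestral S ->
  (forall i, i \in S -> z i 0 = f i z + e i 0) ->
  forall i, i \in S -> sem f e i 0 = z i 0.
Proof.
move=> aS ze i; have [m] := ubnP (n - height G i); elim: m i => [//|m IH] i h iS.
rewrite semE ze //; congr (_ + _); apply: df => j Gji; apply: IH; last exact: aS iS.
have := height_edge aG Gji; have := height_lt j; move: h; clear; lia.
Qed.

Lemma sem_coord_cvg (u : nat -> 'cV[R]_n) (z : 'cV[R]_n) :
  (forall i, u N i 0 @[N --> \oo] --> z i 0) ->
  forall i, sem f (u N) i 0 @[N --> \oo] --> sem f z i 0.
Proof.
move=> uz; rewrite /sem.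
suff H m i : iter m (sem_step f (u N)) 0 i 0 @[N --> \oo] --> iter m (sem_step f z) 0 i 0.
  by move=> i; exact: H.
elim: m i => [|m IH] i.
  exact: cvg_cst.
rewrite iterS mxE (_ : (fun N => _) = (fun N => f i (iter m (sem_step f (u N)) 0) + u N i 0)).
  by apply: cvgD; [apply: cf; exact: IH|exact: uz].
by apply/funext => N; rewrite iterS mxE.
Qed.

(** The density of Z: in a topological order the map from z to the noise is triangular with unit
    diagonal, so its Jacobian is 1. *)
Definition density (z : 'cV[R]_n) := \prod_i normal_pdf 0 (sigma i) (z i 0 - f i z).

(* Recovers the noise from the vector with entries z_i for i in S and e_i for
   i outside S. *)
Definition unstruct (S : {set 'I_n}) (v : nat -> R) (k : nat) : R :=
  if insub k is Some i then (if i \in S then v k - f i (colf n v) else v k) else v k.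

Lemma unstructE S v (i : 'I_n) :
  unstruct S v i = if i \in S then v i - f i (colf n v) else v i.
Proof. by rewrite /unstruct valK. Qed.

Lemma normal_pdf_gt0 i x : 0 < normal_pdf 0 (sigma i) x.
Proof.
rewrite normal_pdfE ?gt_eqF // mulr_gt0 ?expR_gt0 //.
by rewrite normal_peak_gt0 // gt_eqF.
Qed.

Section Integrand.
Variables (w : nat -> R -> R) (g : 'cV[R]_n -> R).
Hypothesis hw : forall k, weight (w k).
Hypothesis w_le1 : forall k x, w k x <= 1.
Hypothesis cg : coordcont g.
Hypothesis g_ge0 : forall z, 0 <= g z.
Hypothesis g_le : forall z, g z <= \prod_(i < n) w i (z i 0).

Let w_ge0 k x : 0 <= w k x. Proof. by case: (hw k). Qed.

(** The integrand of the expectation of g(Z) once the nodes of S have passed from noise to latent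
    coordinates. *)
Definition mixed_integrand S (v : nat -> R) :=
  g (sem f (colf n (unstruct S v))) * \prod_i normal_pdf 0 (sigma i) (unstruct S v i).

Definition mixed_weight (S : {set 'I_n}) (k : nat) : R -> R :=
  if insub k is Some i then (if i \in S then w k else noise_weight sigma k)
  else noise_weight sigma k.

Lemma weight_mixed S k : weight (mixed_weight S k).
Proof.
rewrite /mixed_weight; case: insub => [i|]; last exact: weight_noise.
by case: ifP => _ //; exact: weight_noise.
Qed.

Lemma unstruct_cvg S (u : nat -> nat -> R) v : (forall k, u N k @[N --> \oo] --> v k) ->
  forall k, unstruct S (u N) k @[N --> \oo] --> unstruct S v k.
Proof.
move=> uv k; rewrite /unstruct; case: insub => [i|//]; case: ifP => // _.
by apply: (@cvgB _ R^o) => //; apply: cf; exact: colf_cvg.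
Qed.

Lemma sem_unstruct S v i : ancestral S -> i \in S ->
  sem f (colf n (unstruct S v)) i 0 = v i.
Proof.
move=> aS iS; rewrite (@sem_unique S _ (colf n v)) // ?mxE // => j jS.
by rewrite !mxE unstructE jS addrC subrK.
Qed.

(** On S the decay of g supplies the weight and the normal density is bounded by its peak; outside S
    the normal density is the weight and the factor from g is at most 1. *)
Lemma good_mixed S : ancestral S ->
  good (mixed_weight S) (\prod_i (if i \in S then normal_peak (sigma i) else 1))
    (iota 0 n) (mixed_integrand S).
Proof.
move=> aS; split.
  move=> u v uv; have uv' := @unstruct_cvg S _ _ uv; apply: cvgM.
    by apply: cg; apply: sem_coord_cvg; exact: colf_cvg.
  apply: cvg_prodr => i _; apply: cvg_comp (uv' i) _.
  by apply: continuous_normal_pdf; rewrite gt_eqF.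
move=> v; rewrite prod_iota ger0_norm; last first.
  by rewrite mulr_ge0 // prodr_ge0 // => i _; exact: normal_pdf_ge0.
rewrite -big_split /=; apply: (@le_trans _ _
  ((\prod_(i < n) w i (sem f (colf n (unstruct S v)) i 0)) *
   \prod_i normal_pdf 0 (sigma i) (unstruct S v i))).
  by rewrite ler_wpM2r // prodr_ge0 // => i _; exact: normal_pdf_ge0.
rewrite -big_split /=; apply: ler_prod => i _.
rewrite mulr_ge0 ?normal_pdf_ge0 //= unstructE /mixed_weight valK.
case: ifP => iS.
  rewrite sem_unstruct // mulrC ler_wpM2r //.
  by apply: normal_pdf_ub; rewrite gt_eqF.
by rewrite mul1r noise_weightE ler_piMl // normal_pdf_ge0.
Qed.

Lemma mixed_integrand_ge0 S v : 0 <= mixed_integrand S v.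
Proof. by rewrite mulr_ge0 // prodr_ge0 // => i _; exact: normal_pdf_ge0. Qed.

Lemma iints_mixed S : ancestral S ->
  iints (iota 0 n) (mixed_integrand finset.set0) = iints (iota 0 n) (mixed_integrand S).
Proof.
have [m] := ubnP #|S|; elim: m S => [//|m IH] S; rewrite ltnS => Sm aS.
have [->//|[i0 i0S]] := set_0Vmem S.
(* A node of least height in S has no child in S. Removing it keeps S ancestral, and no [f j] with j
   in S reads its coordinate, so its substitution is a translation. *)
case: (arg_minnP (height G) i0S) => i iS imin.
have {}iS : i \in S by [].
have {}imin j : j \in S -> (height G i <= height G j)%N by exact: imin.
have nGi j : j \in S -> ~~ G i j.
  move=> jS; apply/negP => /(height_edge aG); rewrite ltnNge => /negP; apply; exact: imin.
have aS' : ancestral (S :\ i).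
  move=> j k Gkj; rewrite !inE => /andP[ji jS]; rewrite (aS _ _ Gkj jS) andbT.
  by apply/eqP => ki; move: (nGi j jS); rewrite -ki Gkj.
have Sm' : (#|S :\ i| < m)%N by rewrite (leq_trans _ Sm) // [in leqRHS](cardsD1 i) iS.
rewrite (IH _ Sm' aS').
have fupd j v x : j \in S -> f j (colf n (upd v i x)) = f j (colf n v).
  move=> jS; apply: df => k Gkj; rewrite !mxE upd_neq //.
  by apply/eqP => /val_inj ki; move: (nGi j jS); rewrite -ki Gkj.
have E : mixed_integrand S =
    (fun v => mixed_integrand (S :\ i) (upd v i (v i + (- f i (colf n v))))).
  apply/funext => v; rewrite /mixed_integrand; have <- : unstruct S v = unstruct (S :\ i) (upd v i (v i - f i (colf n v))).
    apply/funext => k; rewrite /unstruct; case: insubP => [j _ <-|kn].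
      rewrite !inE; have [->|ji] := eqVneq j i; first by rewrite iS upd_same.
      rewrite upd_neq; last by rewrite (inj_eq val_inj).
      by case: ifP => // jS; rewrite fupd.
    by rewrite upd_neq //; apply: contraNneq kn => ->.
  by [].
rewrite E; apply: (iints_shift (phi := fun v => - f i (colf n v))
  (weight_mixed (S :\ i)) (weight_mixed S)).
- exact: iota_uniq.
- by rewrite mem_iota /= add0n.
- by move=> v x; rewrite fupd.
- exact: mixed_integrand_ge0.
- exact: good_mixed aS'.
- rewrite -E; exact: good_mixed aS.
Qed.

Lemma expect_sem : gauss_expect sigma (fun e => g (sem f e)) =
  iints (iota 0 n) (fun v => g (colf n v) * density (colf n v)) (fun=> 0).
Proof.
have aT : ancestral [set: 'I_n]%SET by move=> i j _ _; rewrite inE.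
rewrite expectE; transitivity (iints (iota 0 n) (mixed_integrand finset.set0) (fun=> 0)).
  congr iints; apply/funext => v; rewrite /mixed_integrand.
  have u0 : unstruct finset.set0 v = v.
    by apply/funext => k; rewrite /unstruct; case: insub => // i; rewrite inE.
  by rewrite u0.
rewrite (iints_mixed aT); congr iints; apply/funext => v; rewrite /mixed_integrand.
congr (g _ * _); first by apply/colP => i; rewrite sem_unstruct ?inE // mxE.
by apply: eq_bigr => i _; rewrite unstructE inE mxE.
Qed.

Lemma density_gt0 z : 0 < density z.
Proof. by apply: prodr_gt0 => i _; exact: normal_pdf_gt0. Qed.

Lemma density_le z : density z <= \prod_i normal_peak (sigma i).
Proof.
apply: ler_prod => i _; rewrite normal_pdf_ge0 /=.
by apply: normal_pdf_ub; rewrite gt_eqF.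
Qed.

Lemma density_coordcont : coordcont density.
Proof.
move=> u z uz; apply: cvg_prodr => i _.
apply: (@cvg_comp _ _ _ (fun N => u N i 0 - f i (u N)) (normal_pdf 0 (sigma i)) _
  (nbhs (z i 0 - f i z))).
  by apply: (@cvgB _ R^o); [exact: uz|exact: cf].
by apply: continuous_normal_pdf; rewrite gt_eqF.
Qed.

End Integrand.
End StructuralModel.

(** * Concentration of the Gaussian kernel *)

Section Kernel.
Variable R : realType.

Definition gkernel d (x : 'cV[R]_d) := expR (- (\sum_i x i 0 ^+ 2 / 2)).

Lemma gkernel_ge0 d (x : 'cV[R]_d) : 0 <= gkernel x.
Proof. exact: expR_ge0. Qed.

Lemma gkernel_le1 d (x : 'cV[R]_d) : gkernel x <= 1.
Proof.
rewrite -expR0 ler_expR oppr_le0 sumr_ge0 // => i _.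
by rewrite divr_ge0 // sqr_ge0.
Qed.

Lemma gkernel_coordcont d : coordcont (@gkernel d).
Proof.
move=> u z uz; apply: (@cvg_comp _ _ _ (fun N => - (\sum_i u N i 0 ^+ 2 / 2)) expR _
  (nbhs (- (\sum_i z i 0 ^+ 2 / 2)))); last exact: continuous_expR.
apply: (@cvgN _ R^o); apply: cvg_sumr => i _; apply: cvgM; last exact: cvg_cst.
by apply: cvgM; exact: uz.
Qed.

Lemma gkernel_cvg d (x : 'cV[R]_d) :
  \prod_i cos (x i 0 / Num.sqrt N.+1%:R) ^+ N.+1 @[N --> \oo] --> gkernel x.
Proof.
rewrite /gkernel -sumrN expR_sum; apply: cvg_prodr => i _; exact: cos_pow_cvg.
Qed.

(** Since y = L (H y), each entry of y is at most the norm of H y times an absolute row sum of L. *)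
Lemma mulmx_coercive n d (H : 'M[R]_(d, n)) (L : 'M[R]_(n, d)) : L *m H = 1%:M ->
  exists2 c, 0 < c & forall y : 'cV[R]_n,
    c * \sum_k y k 0 ^+ 2 <= \sum_i (H *m y) i 0 ^+ 2.
Proof.
(* The added 1 keeps M positive, hence invertible, in all cases. *)
move=> LH; pose M := \sum_k (\sum_i `|L k i|) ^+ 2 + 1.
have M0 : 0 < M by rewrite ltr_wpDl // sumr_ge0 // => k _; exact: sqr_ge0.
exists M^-1; first by rewrite invr_gt0.
move=> y; set x := H *m y; pose S := \sum_i x i 0 ^+ 2.
have S0 : 0 <= S by apply: sumr_ge0 => i _; exact: sqr_ge0.
rewrite -/S mulrC ler_pdivrMr // mulrDr mulr1.
apply: (@le_trans _ _ (S * \sum_k (\sum_i `|L k i|) ^+ 2)); last by rewrite lerDl.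
rewrite mulr_sumr; apply: ler_sum => k _.
have xS i : `|x i 0| <= Num.sqrt S.
  rewrite -sqrtr_sqr ler_wsqrtr // /S (bigD1 i) //= lerDl.
  by rewrite sumr_ge0 // => j _; exact: sqr_ge0.
have -> : y = L *m x by rewrite mulmxA LH mul1mx.
rewrite -[S in leRHS]sqr_sqrtr // -exprMn -[leLHS]real_normK ?num_real //.
rewrite ler_sqr ?nnegrE ?mulr_ge0 ?sumr_ge0 ?sqrtr_ge0 //.
rewrite mxE (le_trans (ler_norm_sum _ _ _)) // mulr_sumr; apply: ler_sum => i _.
by rewrite normrM mulrC ler_wpM2r.
Qed.

End Kernel.

(** * Gaussian kernels of vanishing width under one model *)

Section OneModel.
Variables (R : realType) (n d : nat) (H : 'M[R]_(d, n)) (L : 'M[R]_(n, d))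
  (G : rel 'I_n) (f : 'I_n -> 'cV[R]_n -> R) (sigma : 'I_n -> R).
Hypothesis LH : L *m H = 1%:M.
Hypothesis aG : acyclic G.
Hypothesis df : forall i, depends_only_on (fun j => G j i) (f i).
Hypothesis cf : forall i, coordcont (f i).
Hypothesis sigma_gt0 : forall i, 0 < sigma i.

Definition observed_expect (h : 'cV[R]_d -> R) :=
  gauss_expect sigma (fun e => h (H *m sem f e)).

Lemma observed_coordcont h : coordcont h -> coordcont (fun e => h (H *m sem f e)).
Proof.
by move=> ch u z uz; apply: ch; apply: cvg_mulmx; exact: sem_coord_cvg.
Qed.

Lemma observed_linear (a b : R) g h : coordcont g -> coordcont h ->
  (forall x, `|g x| <= 1) -> (forall x, `|h x| <= 1) ->
  observed_expect (fun x => a * g x + b * h x) = a * observed_expect g + b * observed_expect h.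
Proof.
move=> cg ch bg bh; apply: (@expect_linear _ _ _ sigma_gt0 1 1) => //.
- exact: observed_coordcont.
- exact: observed_coordcont.
Qed.

Lemma observed_cvg (g_ : nat -> 'cV[R]_d -> R) g :
  (forall N, coordcont (g_ N)) -> coordcont g ->
  (forall N x, `|g_ N x| <= 1) -> (forall x, `|g x| <= 1) ->
  (forall x, g_ N x @[N --> \oo] --> g x) ->
  observed_expect (g_ N) @[N --> \oo] --> observed_expect g.
Proof.
move=> cg_ cg bg_ bg gg; apply: (@expect_cvg _ _ _ sigma_gt0 1) => //.
- by move=> N; exact: observed_coordcont.
- exact: observed_coordcont.
Qed.

Lemma sem_surj z : exists e, sem f e = z.
Proof.
exists (\col_i (z i 0 - f i z)); apply/colP => i.
have aT : ancestral G [set: 'I_n]%SET by move=> ? ? _ _; rewrite inE.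
apply: (sem_unique aG df aT); last by rewrite inE.
by move=> j _; rewrite mxE addrC subrK.
Qed.

(** The bound 2 suits the functions 1 - cos to which this is applied. *)
Lemma observed_eq0 g : coordcont g -> (forall x, 0 <= g x) -> (forall x, g x <= 2) ->
  observed_expect g = 0 -> forall z, g (H *m z) = 0.
Proof.
move=> cg g0 g2 E z; have [e <-] := sem_surj z.
apply: (@expect_eq0 _ _ _ sigma_gt0 2 (fun e => g (H *m sem f e))) => //.
exact: observed_coordcont.
Qed.

(** The constant factor left by the kernel in the small-scale limit; it depends on H only. *)
Definition kernel_mass := iints (iota 0 n) (fun v => gkernel (H *m colf n v)) (fun=> 0).

Let w (c : R) (a : nat -> R) (k : nat) (x : R) := expR (- (c * (x - a k) ^+ 2)).

Let weight_w c a : 0 < c -> forall k, weight (w c a k).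
Proof. by move=> c0 k; exact: weight_gauss. Qed.

Let w_le1 c a : 0 < c -> forall k x, w c a k x <= 1.
Proof.
by move=> c0 k x; rewrite -expR0 ler_expR oppr_le0 mulr_ge0 ?(ltW c0) ?sqr_ge0.
Qed.

Lemma gkernel_mulmx_le : exists2 c, 0 < c & forall y : 'cV[R]_n,
  gkernel (H *m y) <= \prod_(i < n) expR (- (c * y i 0 ^+ 2)).
Proof.
have [c c0 Hc] := mulmx_coercive LH; exists (c / 2); first by rewrite divr_gt0.
move=> y; rewrite -expR_sum sumrN ler_expR lerN2 -mulr_sumr -mulr_suml.
by rewrite mulrAC ler_wpM2r.
Qed.

Lemma gkernel_at_coordcont (s : R) (x0 : 'cV[R]_d) :
  coordcont (fun x => gkernel (s *: (x - x0))).
Proof.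
move=> u x ux; apply: gkernel_coordcont => i.
rewrite !mxE (_ : (fun N => _) = (fun N => s * (u N i 0 - x0 i 0))); last first.
  by apply/funext => N; rewrite !mxE.
by apply: cvgM; [exact: cvg_cst|apply: cvgB; [exact: ux|exact: cvg_cst]].
Qed.

Let mulmx_coordcont (h : 'cV[R]_d -> R) : coordcont h -> coordcont (fun z => h (H *m z)).
Proof. by move=> ch u z uz; apply: ch; exact: cvg_mulmx. Qed.

Lemma observed_gkernel (z0 : 'cV[R]_n) (e : R) : 0 < e ->
  observed_expect (fun x => gkernel (e^-1 *: (x - H *m z0))) =
  e ^+ n * iints (iota 0 n)
    (fun v => gkernel (H *m colf n v) * density f sigma (z0 + e *: colf n v)) (fun=> 0).
Proof.
move=> e0; have [c c0 Hc] := gkernel_mulmx_le.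
pose a (k : nat) : R := if insub k is Some i then z0 i 0 else 0.
have aE (i : 'I_n) : a i = z0 i 0 by rewrite /a valK.
(* Shrinking the kernel by e multiplies its rate of decay around z0 by e^-2. *)
pose c' := c / e ^+ 2; have c'0 : 0 < c' by rewrite divr_gt0 // exprn_gt0.
pose g z := gkernel (e^-1 *: (H *m z - H *m z0)).
have cg : coordcont g := mulmx_coordcont (@gkernel_at_coordcont e^-1 (H *m z0)).
have g_le z : g z <= \prod_(i < n) w c' a i (z i 0).
  rewrite /g -mulmxBr scalemxAr (le_trans (Hc _)) //; apply: ler_prod => i _.
  rewrite expR_ge0 /= ler_expR lerN2 !mxE aE le_eqVlt; apply/orP; left; apply/eqP.
  by rewrite /c'; field; rewrite gt_eqF.
rewrite (_ : observed_expect _ = gauss_expect sigma (fun e => g (sem f e))) //.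
have -> := @expect_sem _ _ _ _ _ aG df cf sigma_gt0 (w c' a) g (weight_w a c'0)
  (w_le1 a c'0) cg (fun z => gkernel_ge0 _) g_le.
have gd : good (w c' a) (\prod_i normal_peak (sigma i)) (iota 0 n ++ [::])
    (fun v => g (colf n v) * density f sigma (colf n v)).
  rewrite cats0; split.
    move=> u v uv; apply: cvgM; first by apply: cg; exact: colf_cvg.
    by apply: (density_coordcont cf sigma_gt0); exact: colf_cvg.
  move=> v; have d0 := density_gt0 f sigma_gt0 (colf n v).
  rewrite ger0_norm; last by rewrite mulr_ge0 ?gkernel_ge0 ?ltW.
  rewrite mulrC ler_pM ?gkernel_ge0 ?(ltW d0) ?density_le //.
  rewrite prod_iota (le_trans (g_le _)) //; apply: ler_prod => i _.
  by rewrite mxE lexx expR_ge0.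
rewrite (iints_affine (weight_w a c'0) a (fun=> 0) e0 _ gd) ?size_iota; last 2 first.
- by rewrite cats0 iota_uniq.
- by move=> v; rewrite mulr_ge0 ?gkernel_ge0 // ltW // density_gt0.
congr (_ * iints _ _ _); apply/funext => v.
have -> : colf n (affine (iota 0 n) a v e) = z0 + e *: colf n v.
  by apply/colP => i; rewrite !mxE /affine mem_iota /= add0n ltn_ord aE.
rewrite /g mulmxDr addrAC subrr add0r scalemxAr scalerA mulVf ?scale1r //.
by rewrite gt_eqF.
Qed.

(** In the coordinates rescaled by 1 / (N + 1) the density is evaluated at points tending to z0; it
    is continuous and bounded by the product of the peaks, so dominated convergence applies. *)
Lemma gkernel_density_cvg (z0 : 'cV[R]_n) :
  N.+1%:R ^+ n * observed_expect (fun x => gkernel (N.+1%:R *: (x - H *m z0)))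
    @[N --> \oo] --> density f sigma z0 * kernel_mass.
Proof.
have [c c0 Hc] := gkernel_mulmx_le; pose a (k : nat) : R := 0.
pose F e v := gkernel (H *m colf n v) * density f sigma (z0 + e *: colf n v).
have E N : N.+1%:R ^+ n * observed_expect (fun x => gkernel (N.+1%:R *: (x - H *m z0))) =
    iints (iota 0 n) (F N.+1%:R^-1) (fun=> 0).
  have := @observed_gkernel z0 N.+1%:R^-1; rewrite invrK => -> //.
  by rewrite mulrA -exprMn divff // expr1n mul1r.
have cgH : coordcont (fun z => gkernel (H *m z)).
  exact: (mulmx_coordcont (@gkernel_coordcont R d)).
have gdF e : good (w c a) (\prod_i normal_peak (sigma i)) (iota 0 n ++ [::]) (F e).
  rewrite cats0; split.
    move=> u v uv; apply: cvgM; first by apply: cgH; exact: colf_cvg.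
    apply: (density_coordcont cf sigma_gt0) => i.
    rewrite !mxE (_ : (fun N => _) = (fun N => z0 i 0 + e * u N i)); last first.
      by apply/funext => N; rewrite !mxE.
    by apply: cvgD; [exact: cvg_cst|apply: cvgM; [exact: cvg_cst|exact: uv]].
  move=> v; have d0 := density_gt0 f sigma_gt0 (z0 + e *: colf n v).
  rewrite ger0_norm; last by rewrite mulr_ge0 ?gkernel_ge0 ?ltW.
  rewrite mulrC ler_pM ?gkernel_ge0 ?(ltW d0) ?density_le //.
  rewrite prod_iota (le_trans (Hc _)) //; apply: ler_prod => i _.
  by rewrite mxE /w /a subr0 lexx expR_ge0.
have uI : uniq (iota 0 n ++ [::]) by rewrite cats0 iota_uniq.
have gd : good (w c a) 1 (iota 0 n ++ [::]) (fun v => gkernel (H *m colf n v)).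
  rewrite cats0; split.
    move=> u v uv; apply: (mulmx_coordcont (@gkernel_coordcont R d)).
    exact: colf_cvg.
  move=> v; rewrite ger0_norm ?gkernel_ge0 // mul1r prod_iota (le_trans (Hc _)) //.
  by apply: ler_prod => i _; rewrite mxE /w /a subr0 lexx expR_ge0.
rewrite (_ : (fun N => _) = (fun N => iints (iota 0 n) (F N.+1%:R^-1) (fun=> 0))); last first.
  by apply/funext => N; exact: E.
(* At scale 0 the density is constant and leaves the integral; the second term of [iints_linear] is
   given coefficient 0. *)
have -> : density f sigma z0 * kernel_mass = iints (iota 0 n) (F 0) (fun=> 0).
  have := iints_linear (weight_w a c0) (density f sigma z0) 0 (fun=> 0) uI gd (gdF 0).
  rewrite mul0r addr0 => <-.
  by congr iints; apply/funext => v; rewrite /F scale0r addr0 mul0r addr0 mulrC.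
apply: (iints_dominated_cvg (weight_w a c0) uI) => // v.
apply: cvgM; first exact: cvg_cst.
apply: (density_coordcont cf sigma_gt0) => i.
rewrite !mxE (_ : (fun N => _) = (fun N => z0 i 0 + N.+1%:R^-1 * v i)); last first.
  by apply/funext => N; rewrite !mxE.
apply: cvgD; first exact: cvg_cst.
by apply: cvgM; [exact: cvg_harmonic|exact: cvg_cst].
Qed.

Lemma kernel_mass_gt0 : 0 < kernel_mass.
Proof.
have [c c0 Hc] := gkernel_mulmx_le; pose a (k : nat) : R := 0.
have uI : uniq (iota 0 n ++ [::]) by rewrite cats0 iota_uniq.
have gd : good (w c a) 1 (iota 0 n ++ [::]) (fun v => gkernel (H *m colf n v)).
  rewrite cats0; split.
    move=> u v uv; apply: (mulmx_coordcont (@gkernel_coordcont R d)).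
    exact: colf_cvg.
  move=> v; rewrite ger0_norm ?gkernel_ge0 // mul1r prod_iota (le_trans (Hc _)) //.
  by apply: ler_prod => i _; rewrite mxE /w /a subr0 lexx expR_ge0.
rewrite lt_neqAle iints_ge0 ?andbT; last by move=> v; exact: gkernel_ge0.
apply/eqP => /esym K0.
have := iints_eq0 (weight_w a c0) uI gd (fun=> gkernel_ge0 _) K0 (v' := fun=> 0) (fun _ _ => erefl).
by apply/eqP; rewrite gt_eqF // expR_gt0.
Qed.

End OneModel.

(** * Models with the same law *)

Section SameLaw.
Variables (R : realType) (n d : nat).
Variables (H H0 : 'M[R]_(d, n)) (G G0 : rel 'I_n) (f f0 : 'I_n -> 'cV[R]_n -> R)
  (sigma sigma0 : 'I_n -> R).
Hypotheses (rH : \rank H = n) (rH0 : \rank H0 = n).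
Hypotheses (aG : acyclic G) (aG0 : acyclic G0).
Hypothesis df : forall i, depends_only_on (fun j => G j i) (f i).
Hypothesis df0 : forall i, depends_only_on (fun j => G0 j i) (f0 i).
Hypotheses (cf : forall i, coordcont (f i)) (cf0 : forall i, coordcont (f0 i)).
Hypotheses (sigma_gt0 : forall i, 0 < sigma i) (sigma0_gt0 : forall i, 0 < sigma0 i).
Hypothesis same_law : law_X H f sigma = law_X H0 f0 sigma0.

Let E1 := observed_expect H f sigma.
Let E2 := observed_expect H0 f0 sigma0.

Let phase (t : 'cV[R]_d) (th : R) (x : 'cV[R]_d) : R := cos ((t^T *m x) 0 0 + th).

Let phase_coordcont t th : coordcont (phase t th).
Proof.
move=> u x ux.
apply: (@cvg_comp _ _ _ (fun N => (t^T *m u N) 0 0 + th) cos _ (nbhs ((t^T *m x) 0 0 + th))).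
  apply: cvgD; last exact: cvg_cst.
  exact: (@cvg_mulmx R d 1 t^T u x ux 0).
exact: continuous_cos.
Qed.

Let phase_le1 t th x : `|phase t th x| <= 1.
Proof. by rewrite ler_norml cos_geN1 cos_le1. Qed.

Let sin_coordcont (t : 'cV[R]_d) : coordcont (fun x : 'cV[R]_d => sin ((t^T *m x) 0 0)).
Proof.
move=> u x ux.
apply: (@cvg_comp _ _ _ (fun N => (t^T *m u N) 0 0) sin _ (nbhs ((t^T *m x) 0 0))).
  exact: (@cvg_mulmx R d 1 t^T u x ux 0).
exact: continuous_sin.
Qed.

(** The addition formula reduces a shifted cosine to the two components of the characteristic
    function. *)
Lemma phase_law t th : E1 (phase t th) = E2 (phase t th).
Proof.
have [lc ls] : E1 (fun x => cos ((t^T *m x) 0 0)) = E2 (fun x => cos ((t^T *m x) 0 0)) /\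
    E1 (fun x => sin ((t^T *m x) 0 0)) = E2 (fun x => sin ((t^T *m x) 0 0)).
  have := congr1 (fun l => l t) same_law; rewrite /law_X => -[lc ls].
  by split; [exact: lc|exact: ls].
have cc : coordcont (fun x : 'cV[R]_d => cos ((t^T *m x) 0 0)).
  have := @phase_coordcont t 0; congr coordcont.
  by apply/funext => x; rewrite /phase addr0.
have -> : phase t th = fun x =>
    cos th * cos ((t^T *m x) 0 0) + (- sin th) * sin ((t^T *m x) 0 0).
  by apply/funext => x; rewrite /phase cosD; ring.
have c1 (x : 'cV[R]_d) : `|cos ((t^T *m x) 0 0)| <= 1 by rewrite ler_norml cos_geN1 cos_le1.
have s1 (x : 'cV[R]_d) : `|sin ((t^T *m x) 0 0)| <= 1 by exact: sin_max.
rewrite /E1 /E2 !observed_linear //.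
by congr (_ * _ + _ * _).
Qed.

(* The additional phase makes the class stable under multiplication by cosines. *)
Definition law_test (h : 'cV[R]_d -> R) := [/\ coordcont h, forall x, `|h x| <= 1 &
  forall t th, E1 (fun x => phase t th x * h x) = E2 (fun x => phase t th x * h x)].

Lemma law_test1 : law_test (fun=> 1).
Proof.
split=> [u x _|x|t th]; [exact: cvg_cst|by rewrite normr1|].
by under eq_fun do rewrite mulr1; exact: phase_law.
Qed.

Lemma phase_mul_coordcont t th h : coordcont h -> coordcont (fun x => phase t th x * h x).
Proof. by move=> ch u x ux; apply: cvgM; [exact: phase_coordcont|exact: ch]. Qed.

Lemma phase_mul_le1 t th h x : `|h x| <= 1 -> `|phase t th x * h x| <= 1.
Proof. by move=> h1; rewrite normrM mulr_ile1. Qed.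

(* cos a cos b = (cos (a + b) + cos (a - b)) / 2 *)
Lemma law_testM t th h : law_test h -> law_test (fun x => phase t th x * h x).
Proof.
move=> [ch h1 hE]; split; first exact: phase_mul_coordcont.
  by move=> x; exact: phase_mul_le1.
move=> t' th'.
have -> : (fun x => phase t' th' x * (phase t th x * h x)) =
    (fun x => 2^-1 * (phase (t' + t) (th' + th) x * h x) +
              2^-1 * (phase (t' - t) (th' - th) x * h x)).
  apply/funext => x; rewrite /phase.
  have -> : ((t' + t)^T *m x) 0 0 = (t'^T *m x) 0 0 + (t^T *m x) 0 0.
    by rewrite linearD mulmxDl mxE.
  have -> : ((t' - t)^T *m x) 0 0 = (t'^T *m x) 0 0 - (t^T *m x) 0 0.
    by rewrite linearB mulmxBl mxE [X in _ + X]mxE.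
  set a := (t'^T *m x) 0 0; set b := (t^T *m x) 0 0.
  rewrite (_ : a + b + (th' + th) = (a + th') + (b + th)); last by ring.
  rewrite (_ : a - b + (th' - th) = (a + th') - (b + th)); last by ring.
  by move: (a + th') (b + th) => p q; rewrite cosD cosB; field.
have pc t2 th2 := @phase_mul_coordcont t2 th2 h ch.
have p1 t2 th2 x := @phase_mul_le1 t2 th2 h x (h1 x).
by rewrite /E1 /E2 !observed_linear // -/E1 -/E2 !hE.
Qed.

Lemma law_test_prod (I : Type) (r : seq I) (t : I -> 'cV[R]_d) (th : I -> R) N :
  law_test (fun x => \prod_(i <- r) phase (t i) (th i) x ^+ N).
Proof.
elim: r => [|i r IH].
  by rewrite (_ : (fun x => _) = (fun=> 1)); [exact: law_test1|apply/funext => x; rewrite big_nil].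
suff H' M : law_test (fun x => phase (t i) (th i) x ^+ M *
    \prod_(i <- r) phase (t i) (th i) x ^+ N).
  by have := H' N; congr law_test; apply/funext => x; rewrite big_cons.
elim: M => [|M IHM].
  by have := IH; congr law_test; apply/funext => x; rewrite expr0 mul1r.
have := law_testM (t i) (th i) IHM.
by congr law_test; apply/funext => x; rewrite exprS mulrA.
Qed.

Lemma law_test_expect h : law_test h -> E1 h = E2 h.
Proof.
case=> _ _ /(_ 0 0); rewrite (_ : (fun x => phase 0 0 x * h x) = h) //.
by apply/funext => x; rewrite /phase trmx0 mul0mx mxE addr0 cos0 mul1r.
Qed.

Lemma expect_gkernel (s : R) (x0 : 'cV[R]_d) :
  E1 (fun x => gkernel (s *: (x - x0))) = E2 (fun x => gkernel (s *: (x - x0))).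
Proof.
pose h (N : nat) (x : 'cV[R]_d) := \prod_i cos ((s *: (x - x0)) i 0 / Num.sqrt N.+1%:R) ^+ N.+1.
have hE N : law_test (h N).
  (* Frequency r along the i-th axis with phase - r x0_i gives the i-th cosine of [h N]; the phases
     centre the product at x0. *)
  pose r : R := s / Num.sqrt N.+1%:R.
  have := @law_test_prod _ (index_enum 'I_d) (fun i => r *: delta_mx i 0)
    (fun i => - (r * x0 i 0)) N.+1.
  congr law_test; apply/funext => x; apply: eq_bigr => i _; congr (_ ^+ _).
  rewrite /phase; congr cos; rewrite linearZ /= -scalemxAl mxE trmx_delta -rowE !mxE /r.
  by ring.
have cg := @gkernel_at_coordcont R d s x0.
have c1 : E1 (h N) @[N --> \oo] --> E1 (fun x => gkernel (s *: (x - x0))).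
  apply: observed_cvg => //.
  - by move=> N; have [] := hE N.
  - by move=> N x; have [] := hE N.
  - by move=> x; rewrite ger0_norm ?gkernel_le1 ?gkernel_ge0.
  - by move=> x; exact: gkernel_cvg.
have c2 : E2 (h N) @[N --> \oo] --> E2 (fun x => gkernel (s *: (x - x0))).
  apply: observed_cvg => //.
  - by move=> N; have [] := hE N.
  - by move=> N x; have [] := hE N.
  - by move=> x; rewrite ger0_norm ?gkernel_le1 ?gkernel_ge0.
  - by move=> x; exact: gkernel_cvg.
have EE : (fun N => E1 (h N)) = (fun N => E2 (h N)).
  by apply/funext => N; rewrite (law_test_expect (hE N)).
by rewrite EE in c1; rewrite -(cvg_lim (@Rhausdorff R) c1) (cvg_lim (@Rhausdorff R) c2).
Qed.

(** If t annihilates H, then cos (s t.X) has expectation 1 in the first model and hence in the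
    second. There 1 - cos (s t.X) is continuous, non-negative and of expectation 0, so it vanishes
    at every H0 z. *)
Lemma annihilator_sub (t : 'cV[R]_d) : t^T *m H = 0 -> t^T *m H0 = 0.
Proof.
move=> tH.
have key (s : R) (z : 'cV[R]_n) : cos (s * (t^T *m (H0 *m z)) 0 0) = 1.
  have ph0 (x : 'cV[R]_d) : phase (s *: t) 0 x = cos (s * (t^T *m x) 0 0).
    by rewrite /phase addr0 linearZ /= -scalemxAl mxE.
  have E1c : E1 (phase (s *: t) 0) = E1 (phase 0 0).
    rewrite /E1 /observed_expect; congr gauss_expect; apply/funext => e.
    rewrite ph0 mulmxA tH mul0mx mxE mulr0 cos0.
    by rewrite /phase trmx0 mul0mx mxE addr0 cos0.
  have E0 : E2 (fun x => 1 * phase 0 0 x + (- 1) * phase (s *: t) 0 x) = 0.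
    by rewrite /E2 observed_linear // -/E2 -!phase_law E1c; ring.
  have p1 (x : 'cV[R]_d) : phase 0 0 x = 1 by rewrite /phase trmx0 mul0mx mxE addr0 cos0.
  have cg : coordcont (fun x => 1 * phase 0 0 x + (- 1) * phase (s *: t) 0 x).
    move=> u x ux; apply: cvgD; apply: cvgM;
      [exact: cvg_cst|exact: phase_coordcont|exact: cvg_cst|exact: phase_coordcont].
  have b x : 0 <= 1 * phase 0 0 x + (- 1) * phase (s *: t) 0 x <= 2.
    rewrite p1; have := @phase_le1 (s *: t) 0 x; rewrite ler_norml => /andP[h1 h2].
    by apply/andP; split; lra.
  have := @observed_eq0 R n d H0 G0 f0 sigma0 aG0 df0 cf0 sigma0_gt0 _ cg
    (fun x => proj1 (andP (b x))) (fun x => proj2 (andP (b x))) E0 z.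
  by rewrite p1 ph0; lra.
(* Were the value c non-zero, the choice s = pi / c would give cos pi = -1 instead of 1. *)
have z0 (z : 'cV[R]_n) : (t^T *m (H0 *m z)) 0 0 = 0.
  apply/eqP; apply: contraT => c0; have := key (pi / (t^T *m (H0 *m z)) 0 0) z.
  by rewrite divfK // cospi; lra.
apply/rowP => j; have := z0 (ecv R j); rewrite mulmxA mxE (bigD1 j) //= big1 ?addr0.
  by rewrite [ecv R j j 0]mxE eqxx mulr1 => ->; rewrite mxE.
by move=> k /negbTE kj; rewrite [ecv R j k 0]mxE kj mulr0.
Qed.

(** The columns of [cokermx H^T] annihilate H and therefore H0, so the columns of H0 lie in the span
    of those of H; the rank of H0 makes the transition matrix invertible. *)
Lemma column_space : exists A B : 'M[R]_n, [/\ A *m B = 1%:M, B *m A = 1%:M & H = H0 *m A].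
Proof.
have /submxP[D HD] : (H0^T <= H^T)%MS.
  rewrite submxE; apply/eqP/matrixP => i j; pose t := col j (cokermx H^T).
  have tH : t^T *m H = 0.
    apply: trmx_inj; rewrite trmx_mul trmxK trmx0 /t colE mulmxA mulmx_coker.
    exact: mul0mx.
  have := annihilator_sub tH => /(congr1 trmx); rewrite trmx_mul trmxK trmx0 => tH0.
  have := congr1 (fun M : 'cV[R]_n => M i 0) tH0.
  by rewrite /t colE mulmxA -colE !mxE.
have HB : H0 = H *m D^T by rewrite -[H0]trmxK HD trmx_mul trmxK.
have uB : D^T \in unitmx.
  rewrite -row_free_unit -row_leq_rank; rewrite -[leqLHS]rH0 HB.
  exact: mxrankM_maxr.
exists (invmx D^T), D^T; split; [exact: mulVmx|exact: mulmxV|].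
by rewrite HB -mulmxA mulmxV // mulmx1.
Qed.

Lemma left_inverse (K : 'M[R]_(d, n)) : \rank K = n -> exists L, L *m K = 1%:M.
Proof. by move=> rK; apply/row_fullP; rewrite /row_full rK. Qed.

Lemma densityE (S : rel 'I_n) (g : 'I_n -> 'cV[R]_n -> R) s z : (forall i, 0 < s i) ->
  density g s z = (\prod_i normal_peak (s i)) * expR (- (energy S g s 0 z / 2)).
Proof.
move=> s0; rewrite /energy mulr_suml -sumrN expR_sum -big_split /=.
apply: eq_bigr => i _; rewrite normal_pdfE ?gt_eqF // /normal_fun /residual subr0.
by congr (_ * expR _); rewrite -mulr_natr; field; rewrite gt_eqF.
Qed.

(** The latent vector with zero noise has zero residuals, so the minimum 0 of the energy is
    attained. *)
Lemma energy_sem0 (S : rel 'I_n) (g : 'I_n -> 'cV[R]_n -> R) s : acyclic S ->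
  (forall i, depends_only_on (fun j => S j i) (g i)) ->
  energy S g s 0 (sem g 0) = 0.
Proof.
move=> aS dg; apply: big1 => i _; rewrite /residual [sem g 0 i 0](semE aS dg) mxE addr0.
by rewrite subrr expr0n /= mul0r.
Qed.

Lemma energy_transfer : exists A B : 'M[R]_n,
  [/\ A *m B = 1%:M, B *m A = 1%:M, H = H0 *m A &
      forall z, energy G f sigma 0 z = energy G0 f0 sigma0 0 (A *m z)].
Proof.
have [A [B [AB BA HA]]] := column_space; exists A, B; split => // z.
have [L LH] := left_inverse rH; have [L0 LH0] := left_inverse rH0.
have mass := kernel_mass_gt0 LH; have mass0 := kernel_mass_gt0 LH0.
have D z' : density f sigma z' * kernel_mass H = density f0 sigma0 (A *m z') * kernel_mass H0.
  have c1 := @gkernel_density_cvg _ _ _ _ _ _ _ _ LH aG df cf sigma_gt0 z'.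
  have c2 := @gkernel_density_cvg _ _ _ _ _ _ _ _ LH0 aG0 df0 cf0 sigma0_gt0 (A *m z').
  rewrite -(cvg_lim (@Rhausdorff R) c1) -(cvg_lim (@Rhausdorff R) c2).
  apply: (congr1 (fun g : nat -> R => lim (g @ \oo))); apply/funext => N.
  by rewrite mulmxA -HA -/E1 -/E2 expect_gkernel.
pose p := \prod_i normal_peak (sigma i) * kernel_mass H.
pose p0 := \prod_i normal_peak (sigma0 i) * kernel_mass H0.
have pp : 0 < p by rewrite mulr_gt0 // prodr_gt0 // => i _; rewrite normal_peak_gt0 // gt_eqF.
have pp0 : 0 < p0 by rewrite mulr_gt0 // prodr_gt0 // => i _; rewrite normal_peak_gt0 // gt_eqF.
(* The additive constant between the energies, up to a factor 2, as the logarithm of the ratio of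
   the normalising constants. *)
pose c := ln (p0 / p).
have Ec z' : energy G f sigma 0 z' = energy G0 f0 sigma0 0 (A *m z') - 2 * c.
  have := D z'; rewrite (densityE G f z' sigma_gt0) (densityE G0 f0 _ sigma0_gt0).
  rewrite mulrAC [RHS]mulrAC -/p -/p0 => /(congr1 (fun x => ln (x / p))).
  rewrite mulrAC divff ?gt_eqF // mul1r expRK mulrAC lnM ?posrE ?divr_gt0 ?expR_gt0 //.
  by rewrite expRK -/c; lra.
(* The zero of the first energy gives c >= 0 and that of the second, pulled back by B, gives c <=
   0. *)
have h1 := Ec (sem f 0); rewrite energy_sem0 // in h1.
have h2 := Ec (B *m sem f0 0); rewrite mulmxA AB mul1mx energy_sem0 // in h2.
have e1 : 0 <= energy G0 f0 sigma0 0 (A *m sem f 0).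
  by apply: sumr_ge0 => i _; exact: residual_ge0.
have e2 : 0 <= energy G f sigma 0 (B *m sem f0 0).
  by apply: sumr_ge0 => i _; exact: residual_ge0.
rewrite Ec; lra.
Qed.

End SameLaw.

Theorem theorem1 (R : realType) (n d : nat) (hn : (0 < n)%N) (hd : (0 < d)%N) :
  exists Zhat : ('cV[R]_d -> R * R) -> ('cV[R]_d -> 'cV[R]_n),
  forall (H : 'M[R]_(d, n)) (G : rel 'I_n) (f : 'I_n -> 'cV[R]_n -> R)
         (sigma : 'I_n -> R),
    \rank H = n ->
    acyclic G ->
    (forall i, depends_only_on (fun j => G j i) (f i)) ->
    (forall i, C2 (f i)) ->
    (forall i, dir_nonlinear (fun j => G j i) (f i)) ->
    (forall i, 0 < sigma i) ->
    exists (s : 'S_n) (C : 'M[R]_n),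
      [/\ forall i, C i i != 0,
          forall (i j : 'I_n) (k l : nat),
            in_layer G k i -> in_layer G l j -> (l < k)%N -> C i j = 0
        & forall z : 'cV[R]_n,
            Zhat (law_X H f sigma) (H *m z) = perm_mx s *m C *m z].
Proof.
(* Zhat phi inverts the mixing matrix of an arbitrary model with law phi. *)
pose explains phi (M : 'M[R]_(n, d)) := exists H0 : 'M[R]_(d, n),
  M *m H0 = 1%:M /\
  exists (G0 : rel 'I_n) (f0 : 'I_n -> 'cV[R]_n -> R) (sigma0 : 'I_n -> R),
  [/\ \rank H0 = n, acyclic G0 & law_X H0 f0 sigma0 = phi] /\
  [/\ forall i, depends_only_on (fun j => G0 j i) (f0 i), forall i, C2 (f0 i),
      forall i, dir_nonlinear (fun j => G0 j i) (f0 i) & forall i, 0 < sigma0 i].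
(* The default 0 is taken only when [phi] is the law of no admissible model; for an actual law, a
   left inverse of the true mixing matrix shows that the set is inhabited. *)
exists (fun phi x => xget 0 (explains phi) *m x).
move=> H G f sigma rH aG df c2 nlf sp.
have [L LH] := left_inverse rH.
have HL : explains (law_X H f sigma) L by exists H; split => //; exists G, f, sigma.
have : explains (law_X H f sigma) (xget 0 (explains (law_X H f sigma))).
  by apply: xgetI; exact: HL.
set M := xget _ _.
move=> [H0 [MH0 [G0 [f0 [sigma0 [[rH0 aG0 lawE] [df0 c20 nlf0 sp0]]]]]]].
have ccont (g : 'I_n -> 'cV[R]_n -> R) : (forall i, C2 (g i)) -> forall i, coordcont (g i).
  move=> cg i; apply: continuous_coordcont => x.
  by have [dg _ _] := cg i; exact: differentiable_continuous.
have [A [B [AB BA HA EA]]] := energy_transfer rH rH0 aG aG0 df df0 (ccont _ c2) (ccont _ c20)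
  sp sp0 (esym lawE).
have [s [C [C0 CL AC]]] := layer_decomposition aG aG0 df df0 nlf nlf0 sp sp0 AB BA EA.
exists s, C; split => // z.
by rewrite -AC HA !mulmxA MH0 mul1mx.
Qed.
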